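(* Let $\Omega=[-X,X)\times[-Y,Y)\subset\mathbb R^2$ with periodic boundary conditions, let $N_x,N_y$ be positive even integers, and let $\epsilon>0$, $\gamma>0$, $M>0$, $\omega\in(0,1)$. Let $\kappa_h,\beta_h$ be constants satisfying $$ \kappa_h\ \ge\ \frac{L_W}{2}+\epsilon\left(\frac{\gamma L_f}{2}\,\|(-\Delta_h)^{-1}\|_{h,L^\infty}\max\{\omega,1-\omega\}+\frac M2|\Omega|\big(L_p^2+L_f\max\{\omega,1-\omega\}\big)\right),\qquad \beta_h\ \ge\ \frac{L_p^2}{2}. $$ Then for any $\tau>0$ and any periodic grid function $\phi_h^n\in\mathcal M_h$, the grid function $\phi_h^{n+1}\in\mathcal M_h$ determined by the fully discrete scheme $$ \begin{aligned} \frac{\phi_h^{n+1}-\phi_h^n}{\tau}=\ &\epsilon\Delta_h\phi_h^{n+1}-\frac{\kappa_h}{\epsilon}\phi_h^{n+1}-\gamma\beta_h(-\Delta_h)^{-1}(\phi_h^{n+1}-\omega)+\frac1\epsilon\big[\kappa_h\phi_h^n-W'(\phi_h^n)\big]\\ &+\gamma\Big[\beta_h(-\Delta_h)^{-1}(\phi_h^n-\omega)-\big((-\Delta_h)^{-1}(f(\phi_h^n)-\omega)\big)f'(\phi_h^n)\Big]-M\big[\langle f(\phi_h^n),1\rangle_h-\omega|\Omega|\big]f'(\phi_h^n) \end{aligned} $$ satisfies $$E_h[\phi_h^{n+1}]\le E_h[\phi_h^n],$$ where $$E_h[\phi_h]=\frac\epsilon2\|\nabla_h\phi_h\|_{h,L^2}^2+\frac1\epsilon\langle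 W(\phi_h),1\rangle_h+\frac\gamma2\big\|(-\Delta_h)^{-\frac12}(f(\phi_h)-\omega)\big\|_{h,L^2}^2+\frac M2\big(\langle f(\phi_h),1\rangle_h-\omega|\Omega|\big)^2 .$$
   Context: Nonlinearities (applied pointwise to grid functions; products of grid functions are pointwise). $f:\mathbb R\to\mathbb R$ is $f(s)=0$ for $s<0$, $f(s)=6s^5-15s^4+10s^3$ for $0\le s\le1$, $f(s)=1$ for $s>1$ (a $C^2$ function). $W:\mathbb R\to\mathbb R$ is the quadratically extended double well: for a fixed $M_{\mathrm{cut}}>0$, $W(s)=18(s^2-s)^2$ for $|s|\le M_{\mathrm{cut}}$, and for $s>M_{\mathrm{cut}}$ (resp. $s<-M_{\mathrm{cut}}$) $W$ is the second-order Taylor polynomial of $18(s^2-s)^2$ at $M_{\mathrm{cut}}$ (resp. $-M_{\mathrm{cut}}$), so $W\in C^2$ has bounded second derivative. $L_W$ and $L_f$ are upper bounds: $|W''(s)|\le L_W$ and $|f''(s)|\le L_f$ for all $s\in\mathbb R$; $L_p$ is a Lipschitz constant of $f$. Grid. $|\Omega|=4XY$, $h_x=2X/N_x$, $h_y=2Y/N_y$, $x_i=-X+ih_x$, $y_j=-Y+jh_y$; $S_h=\{(i,j)\in\mathbb Z^2:1\le i\le N_x,\ 1\le j\le N_y\}$, $\hat S_h=\{(k,l)\in\mathbb Z^2:-\frac{N_x}2+1\le k\le\frac{N_x}2,\ -\frac{N_y}2+1\le l\le\frac{N_y}2\}$. $\mathcal M_h$ is the space of real-valued grid functions $g=(g_{ij})$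 that are periodic: $g_{i+mN_x,\,j+nN_y}=g_{ij}$ for all $(m,n)\in\mathbb Z^2$. For $g,q\in\mathcal M_h$: $\langle g,q\rangle_h=h_xh_y\sum_{(i,j)\in S_h}g_{ij}q_{ij}$, $\|g\|_{h,L^2}^2=\langle g,g\rangle_h$, $\|g\|_{h,L^\infty}=\max_{(i,j)\in S_h}|g_{ij}|$. Discrete Fourier transform $P$: $\hat g_{kl}=(Pg)_{kl}=\frac1{N_xN_y}\sum_{(i,j)\in S_h}g_{ij}e^{-\mathrm i k\pi x_i/X}e^{-\mathrm i l\pi y_j/Y}$ for $(k,l)\in\hat S_h$, with inverse $g_{ij}=\sum_{(k,l)\in\hat S_h}\hat g_{kl}e^{\mathrm i k\pi x_i/X}e^{\mathrm i l\pi y_j/Y}$. Discrete operators. $D_x=P^{-1}\hat D_xP$, $D_y=P^{-1}\hat D_yP$, where $\hat D_x,\hat D_y$ multiply $\hat g_{kl}$ by $\mathrm ik\pi/X$ and $\mathrm il\pi/Y$ respectively. $\nabla_hg=(D_xg,D_yg)^T$ and $\|\nabla_hg\|_{h,L^2}^2=h_xh_y\sum_{(i,j)\in S_h}\big(|(D_xg)_{ij}|^2+|(D_yg)_{ij}|^2\big)$. $\Delta_h=D_x^2+D_y^2$, i.e. $\Delta_h$ multiplies $\hat g_{kl}$ by $-\big[(k\pi/X)^2+(l\pi/Y)^2\big]$. $(-\Delta_h)^{-1}:\mathcal M_h\to\mathcal M_h$ multiplies $\hat g_{kl}$ by $\big[(k\pi/X)^2+(l\pi/Y)^2\big]^{-1}$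 for $(k,l)\ne(0,0)$ and sets the $(0,0)$ mode to $0$. $(-\Delta_h)^{-1/2}$ is its nonnegative square root, so $\|(-\Delta_h)^{-1/2}g\|_{h,L^2}^2=\langle(-\Delta_h)^{-1}g,g\rangle_h$. $\|(-\Delta_h)^{-1}\|_{h,L^\infty}$ is the operator norm of $(-\Delta_h)^{-1}$ on $\mathcal M_h$ with respect to $\|\cdot\|_{h,L^\infty}$. Constants such as $\omega$ and $1$ also denote constant grid functions. Under the conditions on $\kappa_h,\beta_h$ the scheme determines $\phi_h^{n+1}$ uniquely, since the operator $(\frac1\tau+\frac{\kappa_h}\epsilon)I-\epsilon\Delta_h+\gamma\beta_h(-\Delta_h)^{-1}$ has only positive eigenvalues. *)

(* Defs.v *)
From HB Require Import structures.
From mathcomp Require Import all_boot all_order all_algebra.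
From mathcomp Require Import all_classical all_reals all_analysis.
From mathcomp Require Import complex ring lra zify.

Set Implicit Arguments.
Unset Strict Implicit.
Unset Printing Implicit Defensive.

Import Order.TTheory GRing.Theory Num.Theory.
Import numFieldNormedType.Exports.
Import ComplexField.

Local Open Scope classical_set_scope.
Local Open Scope ring_scope.

Section Nonlinearities.
Context {R : realType}.

Definition fphase (s : R) : R :=
  if s < 0 then 0
  else if s <= 1 then 6 * s ^+ 5 - 15 * s ^+ 4 + 10 * s ^+ 3
  else 1.

Definition doublewell (s : R) : R := 18 * (s ^+ 2 - s) ^+ 2.

Definition taylor2 (g : R -> R) (a s : R) : R :=
  g a + derive1 g a * (s - a) + derive1n 2 g a / 2 * (s - a) ^+ 2.

Definition Wext (Mcut s : R) : R :=
  if Mcut < s then taylor2 doublewell Mcut s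
  else if s < - Mcut then taylor2 doublewell (- Mcut) s
  else doublewell s.

End Nonlinearities.

Section Grid.
Context {R : realType}.
Variables (X Y : R) (Nx Ny : nat).

Local Notation C := R[i].
Local Notation grid := (int -> int -> R).
Local Notation cgrid := (int -> int -> C).

Definition area : R := 4 * X * Y.
Definition hx : R := 2 * X / Nx%:R.
Definition hy : R := 2 * Y / Ny%:R.
Definition xgrid (i : int) : R := - X + i%:~R * hx.
Definition ygrid (j : int) : R := - Y + j%:~R * hy.

Definition Mh (g : grid) : Prop :=
  forall i j m n : int, g (i + m * Nx%:Z) (j + n * Ny%:Z) = g i j.

Definition sumS (V : nmodType) (F : int -> int -> V) : V :=
  \sum_(1 <= i < Nx.+1) \sum_(1 <= j < Ny.+1) F i%:Z j%:Z.

(* k = i - Nx/2 with 1 <= i <= Nx runs over -Nx/2 + 1, ..., Nx/2. *)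
Definition sumhatS (V : nmodType) (F : int -> int -> V) : V :=
  sumS (fun i j => F (i - (Nx./2)%:Z) (j - (Ny./2)%:Z)).

Definition inner (g q : grid) : R :=
  hx * hy * sumS (fun i j => g i j * q i j).

Definition sqnormL2 (g : grid) : R := inner g g.

Definition normLinf (g : grid) : R :=
  \big[Num.max/0]_(1 <= i < Nx.+1) \big[Num.max/0]_(1 <= j < Ny.+1)
    `|g i%:Z j%:Z|.

Definition expi (t : R) : C := (cos t +i* sin t)%C.

Definition dft (g : cgrid) (k l : int) : C :=
  ((Nx * Ny)%:R)^-1 *
  sumS (fun i j => g i j * expi (- (k%:~R * pi * xgrid i / X))
                         * expi (- (l%:~R * pi * ygrid j / Y))).

Definition idft (u : cgrid) (i j : int) : C :=
  sumhatS (fun k l => u k l * expi (k%:~R * pi * xgrid i / X)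
                            * expi (l%:~R * pi * ygrid j / Y)).

Definition Dx (g : cgrid) : cgrid :=
  idft (fun k l => (0 +i* (k%:~R * pi / X))%C * dft g k l).
Definition Dy (g : cgrid) : cgrid :=
  idft (fun k l => (0 +i* (l%:~R * pi / Y))%C * dft g k l).

Definition toC (g : grid) : cgrid := fun i j => (g i j)%:C%C.

(* At the Nyquist frequencies k = Nx/2, l = Ny/2 the grid functions Dx g and
   Dy g are not real-valued even when g is, hence the complex moduli here. *)
Definition sqnorm_grad (g : grid) : R :=
  hx * hy * sumS (fun i j => Normc.normc (Dx (toC g) i j) ^+ 2
                           + Normc.normc (Dy (toC g) i j) ^+ 2).

(* The operators below map real grid functions to real ones, so taking the
   real part discards nothing: see toC_lap and toC_fmult. *)
Definition lap (g : grid) : grid :=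
  fun i j => complex.Re (Dx (Dx (toC g)) i j + Dy (Dy (toC g)) i j).

Definition fmult (mu : int -> int -> R) (g : grid) : grid :=
  fun i j => complex.Re (idft (fun k l => (mu k l)%:C%C * dft (toC g) k l) i j).

Definition symb (k l : int) : R :=
  (k%:~R * pi / X) ^+ 2 + (l%:~R * pi / Y) ^+ 2.

Definition invlap : grid -> grid :=
  fmult (fun k l => if (k == 0) && (l == 0) then 0 else (symb k l)^-1).

Definition invlap_half : grid -> grid :=
  fmult (fun k l =>
    if (k == 0) && (l == 0) then 0 else Num.sqrt (symb k l)^-1).

Definition opnorm_invlap : R :=
  sup [set normLinf (invlap g) | g in [set g | Mh g /\ normLinf g <= 1]].

Definition gconst (c : R) : grid := fun _ _ => c.
Definition gapp (F : R -> R) (g : grid) : grid := fun i j => F (g i j).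
Definition gsub (g q : grid) : grid := fun i j => g i j - q i j.

Definition energy (eps gam M omega Mcut : R) (phi : grid) : R :=
  eps / 2 * sqnorm_grad phi
  + eps^-1 * inner (gapp (Wext Mcut) phi) (gconst 1)
  + gam / 2 * sqnormL2 (invlap_half (gsub (gapp fphase phi) (gconst omega)))
  + M / 2 * (inner (gapp fphase phi) (gconst 1) - omega * area) ^+ 2.

Definition scheme (eps gam M omega Mcut kappa beta tau : R)
    (phi phi' : grid) : Prop :=
  forall i j : int,
    (phi' i j - phi i j) / tau =
      eps * lap phi' i j
      - kappa / eps * phi' i j
      - gam * beta * invlap (gsub phi' (gconst omega)) i j
      + eps^-1 * (kappa * phi i j - derive1 (Wext Mcut) (phi i j))
      + gam * (beta * invlap (gsub phi (gconst omega)) i j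
               - invlap (gsub (gapp fphase phi) (gconst omega)) i j
                 * derive1 fphase (phi i j))
      - M * (inner (gapp fphase phi) (gconst 1) - omega * area)
          * derive1 fphase (phi i j).

End Grid.

Section OneDim.
Context {R : realType}.
Implicit Types (t L : R) (N : nat) (k l i : int).

Lemma expiD s t : @expi R (s + t) = expi s * expi t.
Proof. by rewrite /expi cosD sinD; apply/eqP; rewrite eq_complex /= eqxx addrC eqxx. Qed.

Lemma expi0 : @expi R 0 = 1.
Proof. by rewrite /expi cos0 sin0. Qed.

Lemma conj_expi t : ((expi t)^*)%C = expi (- t).
Proof. by rewrite /expi cosN sinN. Qed.

Lemma expi_2pi_int i : @expi R (i%:~R * (2 * pi)) = 1.
Proof.
have pos n : @expi R (n%:R * (2 * pi)) = 1.
  elim: n => [|n IHn]; first by rewrite mul0r expi0.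
  rewrite -natr1 mulrDl mul1r expiD IHn mul1r /expi.
  by rewrite mulr_natl cos2pi sin2pi.
case: i => n; first exact: pos.
by rewrite NegzE mulrNz mulNr -conj_expi pos conjc1.
Qed.

Lemma expi_neq1 t : 0 < t < 2 * pi -> expi t != 1.
Proof.
move=> /andP[t0 t2]; rewrite eq_complex /= negb_and; apply/orP; left.
have s0 : 0 < sin (t / 2) by apply: sin_gt0_pi; lra.
have -> : t = (t / 2) *+ 2 by rewrite mulr2n -splitr.
rewrite cos_mulr2n cos2sin2; have := exprn_gt0 2 s0.
by move=> ?; apply/eqP; rewrite mulr2n; lra.
Qed.

Lemma expiX t n : expi (n%:R * t) = expi t ^+ n.
Proof.
elim: n => [|n IHn]; first by rewrite mul0r expi0.
by rewrite -natr1 mulrDl mul1r expiD IHn exprSr.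
Qed.

Lemma expi_geo N k : k != 0 -> `|k| < N%:Z ->
  \sum_(1 <= i < N.+1) @expi R ((i : nat)%:R * (k%:~R * (2 * pi) / N%:R)) = 0.
Proof.
move=> k0 kN.
have N0 : (0 < N)%N by case: (N) kN => //; lia.
have NR : (0 : R) < N%:R by rewrite ltr0n.
pose z : R[i] := expi (k%:~R * (2 * pi) / N%:R).
have zN : z ^+ N = 1.
  rewrite /z -expiX -[RHS](expi_2pi_int k); congr expi.
  by field; rewrite gt_eqF.
have z1 : z != 1.
  have pos (m : nat) : (0 < m)%N -> (m < N)%N ->
      @expi R (m%:R * (2 * pi) / N%:R) != 1.
    move=> m0 mN; apply: expi_neq1.
    have p0 := @pi_gt0 R; apply/andP; split.
      by rewrite !mulr_gt0 ?invr_gt0 ?ltr0n.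
    rewrite ltr_pdivrMr // mulrC ltr_pM2l ?ltr_nat //; lra.
  rewrite {zN}/z {z}; case: k k0 kN => m k0 kN; first by apply: pos; lia.
  apply/eqP => zz; have := pos m.+1.
  move/(congr1 (fun x => x^*%C)): zz; rewrite conj_expi conjc1 NegzE mulrNz.
  by rewrite !mulNr opprK => -> /(_ isT); rewrite eqxx => /(_ _)/negP; apply; lia.
under eq_bigr do rewrite expiX -/z.
rewrite big_add1 /= big_mkord.
under eq_bigr do rewrite exprS.
rewrite -mulr_sumr.
have /esym/eqP := subrX1 z N.
by rewrite zN subrr mulf_eq0 subr_eq0 (negPf z1) => /eqP ->; rewrite mulr0.
Qed.

Definition chi L N k i : R[i] :=
  expi (k%:~R * pi * (- L + i%:~R * (2 * L / N%:R)) / L).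

Lemma chi_orth L N k l : L != 0 -> (0 < N)%N -> `|k - l| < N%:Z ->
  \sum_(1 <= i < N.+1) chi L N k (i : nat)%:Z * chi L N (- l) i%:Z
    = (if k == l then N%:R else 0).
Proof.
move=> L0 N0 klN.
have N0R : (N%:R : R) != 0 by rewrite pnatr_eq0 -lt0n.
have E (i : nat) : chi L N k i%:Z * chi L N (- l) i%:Z =
    expi (- ((k - l)%:~R * pi)) *
    expi (i%:R * ((k - l)%:~R * (2 * pi) / N%:R)).
  rewrite /chi -!expiD; congr expi.
  rewrite rmorphN rmorphB /=; field; by rewrite N0R L0.
under eq_bigr do rewrite E.
rewrite -mulr_sumr; case: eqVneq => [->|kl]; last first.
  by rewrite expi_geo ?mulr0 // subr_eq0.
rewrite subrr mul0r oppr0 expi0 mul1r.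
under eq_bigr do rewrite mul0r mul0r mulr0 expi0.
by rewrite sumr_const_nat subSS subn0.
Qed.

Lemma sum_hat_opp (V : nmodType) N (F : int -> V) : ~~ odd N ->
  F (- (N./2)%:Z) = F (N./2)%:Z ->
  \sum_(1 <= i < N.+1) F (- ((i : nat)%:Z - (N./2)%:Z))
    = \sum_(1 <= i < N.+1) F (i%:Z - (N./2)%:Z).
Proof.
move=> evN; have: N = N./2.*2 by rewrite even_halfK.
move: N./2 => h {evN} -> Fh; case: h Fh => [|h] Fh; first by rewrite !big_geq.
rewrite [RHS]big_nat_recr //= big_nat_rev /= big_nat_recl //=.
rewrite addrC; congr (_ + _).
  rewrite !big_add1 /= [LHS]big_nat [RHS]big_nat.
  by apply: eq_bigr => i /andP[_ ih]; congr F; lia.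
rewrite [RHS](_ : _ = F h.+1%:Z); last by congr F; lia.
by rewrite -Fh; congr F; lia.
Qed.

End OneDim.

Section TwoDim.
Context {R : realType}.
Variables (X Y : R) (Nx Ny : nat).
Hypotheses (X0 : X != 0) (Y0 : Y != 0) (Nx0 : (0 < Nx)%N) (Ny0 : (0 < Ny)%N).
Hypotheses (evenNx : ~~ odd Nx) (evenNy : ~~ odd Ny).
Implicit Types (g : int -> int -> R) (u v : int -> int -> R[i]).

Let ex := chi X Nx.
Let ey := chi Y Ny.

Lemma dftE u k l : dft X Y Nx Ny u k l =
  ((Nx * Ny)%:R)^-1 * sumS Nx Ny (fun i j => u i j * ex (- k) i * ey (- l) j).
Proof.
rewrite /dft; congr (_ * _); rewrite /sumS; apply: eq_bigr => i _.
apply: eq_bigr => j _; congr (_ * expi _ * expi _);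
  by rewrite rmorphN /= !mulNr.
Qed.

Lemma idftE u i j :
  idft X Y Nx Ny u i j = sumhatS Nx Ny (fun k l => u k l * ex k i * ey l j).
Proof. by []. Qed.

Lemma sum_pick (V : nmodType) (N : nat) (F : int -> V) (k : int) :
    1 <= k + (N./2)%:Z <= N%:Z ->
  \sum_(1 <= a < N.+1)
    (if (a : nat)%:Z - (N./2)%:Z == k then F (a%:Z - (N./2)%:Z) else 0) = F k.
Proof.
move=> kN; have [m mE] : exists m : nat, Posz m = (k + (N./2)%:Z)%R.
  by exists (absz (k + (N./2)%:Z)); lia.
rewrite (bigD1_seq m) ?iota_uniq ?mem_index_iota //=; last by lia.
rewrite [X in X + _]ifT; last by apply/eqP; lia.
rewrite big1 ?addr0; first by congr F; lia.
by move=> a am; rewrite ifF //; apply/eqP; move/eqP: am; lia.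
Qed.

Lemma dft_idft u k l :
    1 <= k + (Nx./2)%:Z <= Nx%:Z -> 1 <= l + (Ny./2)%:Z <= Ny%:Z ->
  dft X Y Nx Ny (idft X Y Nx Ny u) k l = u k l.
Proof.
move=> hk hl; rewrite dftE.
set hX := (Nx./2)%:Z; set hY := (Ny./2)%:Z.
have NR : ((Nx * Ny)%:R : R[i]) != 0 by rewrite pnatr_eq0 muln_eq0; lia.
apply: (mulfI NR); rewrite mulVKf //.
rewrite /sumS.
transitivity (\sum_(1 <= i < Nx.+1) \sum_(1 <= j < Ny.+1)
  \sum_(1 <= a < Nx.+1) \sum_(1 <= b < Ny.+1)
    u (a%:Z - hX) (b%:Z - hY) *
     ((ex (a%:Z - hX) i%:Z * ex (- k) i%:Z)
      * (ey (b%:Z - hY) j%:Z * ey (- l) j%:Z))).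
  apply: eq_bigr => i _; apply: eq_bigr => j _.
  rewrite idftE /sumhatS /sumS -/hX -/hY !mulr_suml; apply: eq_bigr => a _.
  rewrite !mulr_suml; apply: eq_bigr => b _; ring.
under eq_bigr => i _ do rewrite exchange_big /=.
rewrite exchange_big /=.
under eq_bigr => a _ do under eq_bigr => i _ do rewrite exchange_big /=.
under eq_bigr => a _ do rewrite exchange_big /=.
transitivity (\sum_(1 <= a < Nx.+1) \sum_(1 <= b < Ny.+1)
  u (a%:Z - hX) (b%:Z - hY) *
   ((\sum_(1 <= i < Nx.+1) ex (a%:Z - hX) (i : nat)%:Z * ex (- k) i%:Z) *
    (\sum_(1 <= j < Ny.+1) ey (b%:Z - hY) (j : nat)%:Z * ey (- l) j%:Z))).
  apply: eq_bigr => a _; apply: eq_bigr => b _.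
  rewrite big_distrlr /= mulr_sumr; apply: eq_bigr => i _.
  by rewrite mulr_sumr.
transitivity (\sum_(1 <= a < Nx.+1)
   (if (a : nat)%:Z - hX == k then
      Nx%:R * \sum_(1 <= b < Ny.+1)
        (if (b : nat)%:Z - hY == l then u (a%:Z - hX) (b%:Z - hY) * Ny%:R else 0)
    else 0)).
  rewrite [LHS]big_nat [RHS]big_nat; apply: eq_bigr => a aN.
  rewrite chi_orth //; last by rewrite /hX; lia.
  case: ifP => _; last by rewrite big1 // => b _; rewrite mul0r mulr0.
  rewrite mulr_sumr [LHS]big_nat [RHS]big_nat; apply: eq_bigr => b bN.
  rewrite chi_orth //; last by rewrite /hY; lia.
  by case: ifP => _; rewrite ?mulr0 // mulrCA.
rewrite (@sum_pick _ Nx (fun c => Nx%:R * \sum_(1 <= b < Ny.+1)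
  (if (b : nat)%:Z - hY == l then u c (b%:Z - hY) * Ny%:R else 0))) //.
rewrite (@sum_pick _ Ny (fun c => u k c * Ny%:R)) //.
by rewrite natrM; ring.
Qed.

Lemma sumhatS_opp (V : nmodType) (F : int -> int -> V) :
    (forall l, F (- (Nx./2)%:Z) l = F (Nx./2)%:Z l) ->
    (forall k, F k (- (Ny./2)%:Z) = F k (Ny./2)%:Z) ->
  sumhatS Nx Ny (fun k l => F (- k) (- l)) = sumhatS Nx Ny F.
Proof.
move=> Fx Fy; rewrite /sumhatS /sumS.
rewrite (@sum_hat_opp _ Nx (fun k => \sum_(1 <= j < Ny.+1)
  F k (- (j%:Z - (Ny./2)%:Z)))) //; last by apply: eq_bigr.
by apply: eq_bigr => i _; rewrite (@sum_hat_opp _ Ny (F _)).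
Qed.

Lemma conjM (x y : R[i]) : ((x * y)^*)%C = (x^*)%C * (y^*)%C.
Proof. exact: rmorphM. Qed.

Lemma conj_chi (L : R) N k i : ((chi L N k i)^*)%C = chi L N (- k) i.
Proof. by rewrite conj_expi /chi rmorphN /= !mulNr. Qed.

Lemma chi_nyquist (L : R) N i : L != 0 -> (0 < N)%N -> ~~ odd N ->
  chi L N (- (N./2)%:Z) i = chi L N (N./2)%:Z i.
Proof.
move=> L0 N0 evN; have NE : N = N./2.*2 by rewrite even_halfK.
have h0 : ((N./2)%:R : R) != 0 by rewrite pnatr_eq0; lia.
rewrite -[RHS]mul1r -(expi_2pi_int ((N./2)%:Z - i)) /chi -expiD; congr expi.
have -> : (N%:R : R) = (N./2)%:R * 2 by rewrite {1}NE -muln2 natrM.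
rewrite rmorphB rmorphN /=; field; by rewrite h0 L0.
Qed.

Lemma idft_real (mu : int -> int -> R) g i j :
    (forall k l, mu (- k) l = mu k l) -> (forall k l, mu k (- l) = mu k l) ->
  complex.Im (idft X Y Nx Ny (fun k l => (mu k l)%:C%C * dft X Y Nx Ny (toC g) k l) i j)
    = 0.
Proof.
move=> mux muy.
set z := idft _ _ _ _ _ _ _.
suff : (z^*)%C = z.
  by case: z => a b [] /= ?; lra.
rewrite /z idftE -[RHS]sumhatS_opp; last 2 first.
- move=> l; rewrite mux /ex chi_nyquist // !dftE; congr (_ * (_ * _) * _ * _).
  rewrite /sumS; apply: eq_bigr => a _; apply: eq_bigr => b _.
  by rewrite opprK /ex chi_nyquist.
- move=> k; rewrite muy /ey chi_nyquist // !dftE; congr (_ * (_ * _) * _ * _).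
  rewrite /sumS; apply: eq_bigr => a _; apply: eq_bigr => b _.
  by rewrite opprK /ey chi_nyquist.
rewrite /sumhatS /sumS rmorph_sum /=; apply: eq_bigr => a _.
rewrite rmorph_sum /=; apply: eq_bigr => b _.
rewrite mux muy 3!conjM /ex /ey !conj_chi conjc_real; congr (_ * _ * _ * _).
rewrite !dftE conjM fmorphV rmorph_nat; congr (_ * _).
rewrite /sumS rmorph_sum; apply: eq_bigr => c _.
rewrite rmorph_sum; apply: eq_bigr => d _.
rewrite -[LHS]/((_ * _ * _)^*)%C.
by rewrite 2!conjM /ex /ey !conj_chi !opprK conjc_real.
Qed.

Lemma toC_fmult (mu : int -> int -> R) g :
    (forall k l, mu (- k) l = mu k l) -> (forall k l, mu k (- l) = mu k l) ->
  toC (fmult X Y Nx Ny mu g)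
    = idft X Y Nx Ny (fun k l => (mu k l)%:C%C * dft X Y Nx Ny (toC g) k l).
Proof.
move=> mux muy; apply/funext => i; apply/funext => j.
rewrite /toC /fmult; have := idft_real g i j mux muy.
by case: (idft _ _ _ _ _ _ _) => a b /= ->.
Qed.

Lemma Dx2_Dy2 g i j :
  Dx X Y Nx Ny (Dx X Y Nx Ny (toC g)) i j
  + Dy X Y Nx Ny (Dy X Y Nx Ny (toC g)) i j
  = idft X Y Nx Ny
      (fun k l => (- symb X Y k l)%:C%C * dft X Y Nx Ny (toC g) k l) i j.
Proof.
rewrite /Dx /Dy !idftE /sumhatS /sumS -big_split; apply: eq_big_nat => a aN.
rewrite -big_split; apply: eq_big_nat => b bN /=.
rewrite !dft_idft; try lia.
move: (dft _ _ _ _ _ _ _) => d.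
rewrite -!mulrDl !mulrA -mulrDl; congr (_ * _ * _ * _).
by apply/eqP; rewrite eq_complex /symb /=; apply/andP; split; apply/eqP; ring.
Qed.

Lemma lapE g : lap X Y Nx Ny g = fmult X Y Nx Ny (fun k l => - symb X Y k l) g.
Proof.
by apply/funext => i; apply/funext => j; rewrite /lap Dx2_Dy2.
Qed.

Lemma symbNx k l : symb X Y (- k) l = symb X Y k l.
Proof. by rewrite /symb rmorphN /=; ring. Qed.

Lemma symbNy k l : symb X Y k (- l) = symb X Y k l.
Proof. by rewrite /symb rmorphN /=; ring. Qed.

Lemma toC_lap g : toC (lap X Y Nx Ny g) = fun i j =>
  Dx X Y Nx Ny (Dx X Y Nx Ny (toC g)) i j
  + Dy X Y Nx Ny (Dy X Y Nx Ny (toC g)) i j.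
Proof.
rewrite lapE toC_fmult => [|k l|k l]; rewrite ?symbNx ?symbNy //.
by apply/funext => i; apply/funext => j; rewrite Dx2_Dy2.
Qed.

Lemma toC_invlap g : toC (invlap X Y Nx Ny g) =
  idft X Y Nx Ny (fun k l =>
    (if (k == 0) && (l == 0) then 0 else (symb X Y k l)^-1)%:C%C
      * dft X Y Nx Ny (toC g) k l).
Proof. by apply: toC_fmult => k l; rewrite oppr_eq0 (symbNx, symbNy). Qed.

Lemma toC_invlap_half g : toC (invlap_half X Y Nx Ny g) =
  idft X Y Nx Ny (fun k l =>
    (if (k == 0) && (l == 0) then 0 else Num.sqrt (symb X Y k l)^-1)%:C%C
      * dft X Y Nx Ny (toC g) k l).
Proof. by apply: toC_fmult => k l; rewrite oppr_eq0 (symbNx, symbNy). Qed.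

Lemma fmult_Mh (mu : int -> int -> R) g : Mh Nx Ny (fmult X Y Nx Ny mu g).
Proof.
have per (L : R) N k i m : L != 0 -> (0 < N)%N ->
    chi L N k (i + m * N%:Z) = chi L N k i.
  move=> L0 N0; rewrite -[RHS]mul1r -(expi_2pi_int (k * m)) /chi -expiD.
  congr expi; rewrite rmorphD !rmorphM /=.
  by field; rewrite L0 pnatr_eq0 -lt0n.
move=> i j m n; rewrite /fmult !idftE; congr (complex.Re _).
rewrite /sumhatS /sumS; apply: eq_bigr => a _; apply: eq_bigr => b _.
by rewrite /ex /ey !per.
Qed.

End TwoDim.

(* Main.v *)
(** Testing the scheme against d = phi' - phi, and expanding each part of the
    energy to second order along the segment from phi to phi', leaves only
    second-order terms to be absorbed by kappa and beta. The delicate one is the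
    Hessian of the nonlocal energy, <K(f'd), f'd> + <K a, f'' d^2> with
    K = (-Delta_h)^-1 and a = f - omega: multiplication by f' is not bounded by
    Lp in the K-seminorm, so the two terms cannot be estimated separately.
    Instead one writes f' = 5/6 + (f' - 5/6); Cauchy-Schwarz gives
    <K(f'd), f'd> <= (15/8)^2 <K d, d> + 81/65 <K((f' - 5/6)d), (f' - 5/6)d>, and
    the excess is bounded by the slack Lf - |f''| of the second term, through
    81/65 (f' - 5/6)^2 <= (Lf - |f''|)/2 and max(omega, 1 - omega) >= 1/2. The
    L-infinity operator norm of K enters as the maximal absolute row sum of its
    kernel, which by symmetry also bounds K on l^2. *)

Require Import Defs.
From mathcomp Require Import all_boot all_order all_algebra.
From mathcomp Require Import all_classical all_reals all_analysis.
From mathcomp Require Import complex ring lra zify.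

Set Implicit Arguments.
Unset Strict Implicit.
Unset Printing Implicit Defensive.

Import Order.TTheory GRing.Theory Num.Theory.
Import numFieldNormedType.Exports.

Local Open Scope classical_set_scope.
Local Open Scope ring_scope.

(** * Second-order Taylor bounds and derivatives of glued functions *)

Section Calculus.
Context {R : realType}.
Implicit Types (g dg : R -> R) (a s t : R).

(** The mean value theorem is used twice: on [dg], and then on [k], the difference between [g] and
    its comparison parabola, whose derivative is nonpositive by the first use. *)
Lemma taylor2_le (g dg ddg : R -> R) (C : R) :
    (forall t : R, is_derive t 1 g (dg t)) ->
    (forall t : R, is_derive t 1 dg (ddg t)) ->
    (forall t : R, ddg t <= C) ->
  g 1 <= g 0 + dg 0 + C / 2.
Proof.
move=> hg hdg hC.
have dgle t : 0 <= t -> dg t <= dg 0 + C * t.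
  move=> t0.
  have wc : {within `[0, t], continuous dg}.
    by apply: derivable_within_continuous => x _; have [] := hdg x.
  have [c _ E] := MVT_segment t0 (fun x _ => hdg x) wc.
  rewrite subr0 in E; have := ler_wpM2r t0 (hC c); lra.
pose k := fun t : R => g t - (dg 0 * t + C / 2 * t ^+ 2).
have kE : k = g - horner (dg 0 *: 'X + (C / 2) *: 'X^2).
  by apply/funext => t; rewrite /k !fctE /= !hornerE.
have hk (t : R) : is_derive t 1 k (dg t - (dg 0 + C * t)).
  rewrite kE; apply: is_derive_eq.
  by rewrite derivD !derivZ derivX derivXn /= !(hornerE, hornerMn); lra.
have wc : {within `[0, 1], continuous k}.
  by apply: derivable_within_continuous => x _; have [] := hk x.
have [c] := MVT_segment ler01 (fun x _ => hk x) wc.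
rewrite in_itv /= => /andP[c0 _]; have := dgle c c0.
rewrite /k subr0 mulr1; lra.
Qed.

(** Away from [a] the glued function locally coincides with one piece. At [a] each difference
    quotient is that of [g1] or that of [g2], and both converge to the same limit. *)
Lemma is_derive_glue (a : R) (g1 g2 dg1 dg2 : R -> R) :
    (forall s : R, is_derive s 1 g1 (dg1 s)) ->
    (forall s : R, is_derive s 1 g2 (dg2 s)) ->
    g1 a = g2 a -> dg1 a = dg2 a ->
  forall s : R, is_derive s 1 (fun x => if x < a then g1 x else g2 x)
    (if s < a then dg1 s else dg2 s).
Proof.
move=> h1 h2 e de s; case: (ltgtP s a) => sa.
- apply: near_eq_is_derive (h1 s); near=> x.
  by rewrite ifT //; near: x; exact: lt_nbhsl.
- apply: near_eq_is_derive (h2 s); near=> x.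
  rewrite ifF //; apply/negbTE; rewrite -leNgt ltW //; near: x; exact: lt_nbhsr.
rewrite {s}sa.
have q g dg : (forall s : R, is_derive s 1 g (dg s)) ->
    (fun h => h^-1 *: ((g \o shift a) (h *: (1 : R)) - g a)) @ 0^' --> dg a.
  by move=> h; have [h' <-] := h a; exact: h'.
suff H : (fun h => h^-1 *: (((fun x => if x < a then g1 x else g2 x) \o shift a)
      (h *: (1 : R)) - (if a < a then g1 a else g2 a))) @ 0^' --> dg2 a.
  split; [by apply/cvg_ex; exists (dg2 a) | exact: cvg_lim].
have := q _ _ h2; have := q _ _ h1; rewrite de ltxx.
move=> /cvgrPdist_lt c1 /cvgrPdist_lt c2; apply/cvgrPdist_lt => r r0.
have := c1 r r0; have := c2 r r0 => n2 n1.
near=> h => /=; case: ifP => _.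
  by rewrite -e; near: h; exact: n1.
by near: h; exact: n2.
Unshelve. all: by end_near.
Qed.

Lemma is_derive_derive1 (g dg : R -> R) :
  (forall s : R, is_derive s 1 g (dg s)) -> derive1 g = dg.
Proof.
by move=> h; apply/funext => s; rewrite derive1E; have [_ ->] := h s.
Qed.

Lemma derive1n2 (g dg ddg : R -> R) :
    (forall s : R, is_derive s 1 g (dg s)) ->
    (forall s : R, is_derive s 1 dg (ddg s)) ->
  derive1n 2 g = ddg.
Proof.
by move=> h h'; rewrite derive1nS /= (is_derive_derive1 h) (is_derive_derive1 h').
Qed.

Lemma is_derive_line (g dg : R -> R) (u d t : R) :
    (forall s : R, is_derive s 1 g (dg s)) ->
  is_derive t 1 (fun t => g (u + t * d)) (dg (u + t * d) * d).
Proof.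
move=> h.
have hl : is_derive t 1 (fun t => u + t * d) d.
  have -> : (fun t => u + t * d) = horner (u%:P + d *: 'X).
    by apply/funext => x; rewrite !hornerE; ring.
  apply: is_derive_eq; rewrite derivD derivC derivZ derivX !hornerE; ring.
have := @is_derive1_comp R g (fun t => u + t * d) t _ _ (h _) hl.
by rewrite /comp.
Qed.

End Calculus.

(** * Smoothness of the phase function and of the extended double well *)

Section Nonlinearities.
Context {R : realType}.
Implicit Types (s t u d : R).

Lemma derivXnZ (n : nat) : 'X^n^`() = n%:R *: 'X^(n.-1) :> {poly R}.
Proof. by rewrite derivXn scaler_nat. Qed.

Lemma taylor2_line_le (g dg ddg : R -> R) (C u d : R) :
    (forall s : R, is_derive s 1 g (dg s)) ->
    (forall s : R, is_derive s 1 dg (ddg s)) ->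
    (forall s : R, ddg s <= C) ->
  g (u + d) <= g u + dg u * d + C / 2 * d ^+ 2.
Proof.
move=> hg hdg hC.
have h1 t : is_derive t 1 (fun t => g (u + t * d)) (dg (u + t * d) * d).
  exact: is_derive_line.
have h2 t : is_derive t 1 (fun t => dg (u + t * d) * d)
    (ddg (u + t * d) * d * d).
  have h := is_derive_line u d t hdg.
  have -> : (fun t => dg (u + t * d) * d) = d \*: (fun t => dg (u + t * d)).
    by apply/funext => x; rewrite /GRing.scale_fun mulrC.
  by apply: is_derive_eq; rewrite /GRing.scale /= mulrC.
have := @taylor2_le R _ _ _ (C * d ^+ 2) h1 h2.
rewrite mul1r mul0r addr0 mulrAC; apply=> t.
by rewrite -mulrA -expr2 ler_wpM2r ?sqr_ge0.
Qed.

Let hornerEs := (hornerD, hornerN, hornerZ, hornerXn, hornerX, hornerC).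

Definition dfphase s : R :=
  if s < 0 then 0 else if s < 1 then 30 * s ^+ 2 * (1 - s) ^+ 2 else 0.

Definition ddfphase s : R :=
  if s < 0 then 0 else if s < 1 then 60 * s * (1 - s) * (1 - 2 * s) else 0.

(** The point 1 is moved to the constant branch, where the value is the same, to obtain the strict
    tests that [is_derive_glue] expects. *)
Lemma fphaseE : @fphase R = fun s => if s < 0 then 0 else
  if s < 1 then 6 * s ^+ 5 - 15 * s ^+ 4 + 10 * s ^+ 3 else 1.
Proof.
apply/funext => s; rewrite /fphase; case: ifP => // _.
rewrite le_eqVlt; case: eqVneq => [->|_] //=; rewrite ltxx !expr1n; lra.
Qed.

Lemma is_derive_fphase s : is_derive s 1 (@fphase R) (dfphase s).
Proof.
pose p (s : R) := 6 * s ^+ 5 - 15 * s ^+ 4 + 10 * s ^+ 3.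
pose dp (s : R) := 30 * s ^+ 2 * (1 - s) ^+ 2.
have hp t : is_derive t 1 p (dp t).
  have -> : p = horner (6 *: 'X^5 - 15 *: 'X^4 + 10 *: 'X^3).
    by apply/funext => x; rewrite /p !hornerEs.
  apply: is_derive_eq.
  rewrite !(derivD, derivN, derivZ, derivXnZ) /= !hornerEs /dp; lra.
have hg : forall t : R, is_derive t 1 (fun s => if s < 1 then p s else cst 1 s)
    (if t < 1 then dp t else cst 0 t).
  by apply: is_derive_glue => //; rewrite /p /dp /= ?expr1n; lra.
rewrite fphaseE.
have h0 t : is_derive t 1 (cst 0 : R -> R) (cst 0 t) by exact: is_derive_cst.
apply: (is_derive_glue h0 hg).
- by rewrite /= ltr01 /p !expr0n /=; lra.
- by rewrite /= ltr01 /dp !expr0n /=; lra.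
Qed.

Lemma is_derive_dfphase s : is_derive s 1 dfphase (ddfphase s).
Proof.
pose p (s : R) := 30 * s ^+ 2 * (1 - s) ^+ 2.
pose dp (s : R) := 60 * s * (1 - s) * (1 - 2 * s).
have hp t : is_derive t 1 p (dp t).
  have -> : p = horner (30 *: 'X^4 - 60 *: 'X^3 + 30 *: 'X^2).
    by apply/funext => x; rewrite /p !hornerEs; ring.
  apply: is_derive_eq.
  rewrite !(derivD, derivN, derivZ, derivXnZ) /= !hornerEs /dp; lra.
have hg : forall t : R, is_derive t 1 (fun s => if s < 1 then p s else cst 0 s)
    (if t < 1 then dp t else cst 0 t).
  by apply: is_derive_glue => //; rewrite /p /dp /= ?subrr ?expr0n /=; lra.
have h0 t : is_derive t 1 (cst 0 : R -> R) (cst 0 t) by exact: is_derive_cst.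
apply: (is_derive_glue h0 hg).
- by rewrite /= ltr01 /p !expr0n /=; lra.
- by rewrite /= ltr01 /dp; lra.
Qed.

Lemma Wext_C2 (Mcut : R) : 0 < Mcut -> exists dW ddW : R -> R,
  (forall s : R, is_derive s 1 (Wext Mcut) (dW s)) /\
  (forall s : R, is_derive s 1 dW (ddW s)).
Proof.
move=> M0.
pose dw s : R := 36 * (s ^+ 2 - s) * (2 * s - 1).
pose ddw s : R := 36 * (6 * s ^+ 2 - 6 * s + 1).
have h1 s : is_derive s 1 doublewell (dw s).
  have -> : doublewell = horner (18 *: 'X^4 - 36 *: 'X^3 + 18 *: 'X^2) :> (R -> R).
    by apply/funext => x; rewrite /doublewell !hornerEs; ring.
  apply: is_derive_eq.
  rewrite !(derivD, derivN, derivZ, derivXnZ) /= !hornerEs /dw; lra.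
have h2 s : is_derive s 1 dw (ddw s).
  have -> : dw = horner (72 *: 'X^3 - 108 *: 'X^2 + 36 *: 'X) :> (R -> R).
    by apply/funext => x; rewrite /dw !hornerEs; ring.
  apply: is_derive_eq.
  rewrite !(derivD, derivN, derivZ, derivXnZ, derivX) /= !hornerEs /ddw.
  lra.
pose dT a s : R := dw a + ddw a * (s - a).
have h3 a s : is_derive s 1 (taylor2 doublewell a) (dT a s).
  have -> : taylor2 doublewell a =
      horner ((doublewell a - dw a * a + ddw a / 2 * a ^+ 2)%:P
        + (dw a - ddw a * a) *: 'X + (ddw a / 2) *: 'X^2) :> (R -> R).
    apply/funext => x; rewrite /taylor2 (derive1n2 h1 h2) (is_derive_derive1 h1).
    by rewrite !hornerEs; field.
  apply: is_derive_eq.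
  rewrite !(derivD, derivC, derivZ, derivXnZ, derivX) /=.
  by rewrite !hornerEs /dT; lra.
have h4 a s : is_derive s 1 (dT a) (ddw a).
  have -> : dT a = horner ((dw a - ddw a * a)%:P + ddw a *: 'X) :> (R -> R).
    apply/funext => x.
    by rewrite !hornerEs /dT; ring.
  apply: is_derive_eq.
  by rewrite derivD derivC derivZ derivX add0r hornerZ hornerC mulr1.
(* A second-order Taylor polynomial shares value and first two derivatives with [doublewell] at its
   base point; these are the junction conditions for glueing [Wext] and then its derivative at both
   cut points. *)
exists (fun s => if s < - Mcut then dT (- Mcut) s
                 else if s < Mcut then dw s else dT Mcut s).
exists (fun s => if s < - Mcut then ddw (- Mcut)
                 else if s < Mcut then ddw s else ddw Mcut).
have NM : - Mcut < Mcut by lra.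
split.
  have -> : Wext Mcut = fun s => if s < - Mcut then taylor2 doublewell (- Mcut) s
      else if s < Mcut then doublewell s else taylor2 doublewell Mcut s.
    apply/funext => s; rewrite /Wext; case: (ltrP s (- Mcut)) => sM.
      by rewrite ifF //; apply/negbTE; rewrite -leNgt; lra.
    case: (ltrgtP s Mcut) => // ->.
    by rewrite /taylor2 subrr expr0n /= !mulr0 !addr0.
  have hg : forall s, is_derive s 1
      (fun s => if s < Mcut then doublewell s else taylor2 doublewell Mcut s)
      (if s < Mcut then dw s else dT Mcut s).
    apply: is_derive_glue => //.
      by rewrite /taylor2 subrr expr0n /= !mulr0 !addr0.
    by rewrite /dT subrr mulr0 addr0.
  apply: (is_derive_glue (h3 (- Mcut)) hg).
    by rewrite NM /taylor2 subrr expr0n /= !mulr0 !addr0.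
  by rewrite NM /dT subrr mulr0 addr0.
have hg : forall s, is_derive s 1 (fun s => if s < Mcut then dw s else dT Mcut s)
    (if s < Mcut then ddw s else cst (ddw Mcut) s).
  by apply: is_derive_glue => //; rewrite /dT subrr mulr0 addr0.
apply: (is_derive_glue (dg1 := cst (ddw (- Mcut))) (h4 (- Mcut)) hg).
  by rewrite NM /dT subrr mulr0 addr0.
by rewrite NM.
Qed.

Lemma Wext_taylor_le (Mcut LW u d : R) : 0 < Mcut ->
    (forall s : R, `|derive1n 2 (Wext Mcut) s| <= LW) ->
  Wext Mcut (u + d) <= Wext Mcut u + derive1 (Wext Mcut) u * d + LW / 2 * d ^+ 2.
Proof.
move=> M0; have [dW [ddW [h1 h2]]] := Wext_C2 M0.
rewrite (derive1n2 h1 h2) (is_derive_derive1 h1) => hL.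
by apply: taylor2_line_le h1 h2 _ => s; exact: le_trans (ler_norm _) (hL s).
Qed.

End Nonlinearities.

(** * Pointwise inequalities relating the phase function and its derivatives *)

Section NonlinearityBounds.
Context {R : realType}.
Implicit Types (s x y w : R).

(** Completing the square in 6s^2 - 15s + 10 gives positivity; the upper bound is the same fact at 1
    - s, because f(1 - s) = 1 - f(s). *)
Lemma fphase_ge0_le1 s : 0 <= fphase s <= 1.
Proof.
rewrite fphaseE; case: ltrP => s0; first by rewrite lexx ler01.
case: ltrP => s1; last by rewrite lexx ler01.
have -> : 6 * s ^+ 5 - 15 * s ^+ 4 + 10 * s ^+ 3
  = s ^+ 3 * (6 * (s - 5 / 4) ^+ 2 + 5 / 8) by field.
apply/andP; split.
  by rewrite mulr_ge0 ?exprn_ge0 //; have := sqr_ge0 (s - 5 / 4); lra.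
have : 0 <= (1 - s) ^+ 3 * (6 * (s + 1 / 4) ^+ 2 + 5 / 8).
  rewrite mulr_ge0 ?exprn_ge0 ?subr_ge0 ?(ltW s1) //.
  by have := sqr_ge0 (s + 1 / 4); lra.
have -> : (1 - s) ^+ 3 * (6 * (s + 1 / 4) ^+ 2 + 5 / 8)
  = 1 - s ^+ 3 * (6 * (s - 5 / 4) ^+ 2 + 5 / 8) by field.
by rewrite subr_ge0.
Qed.

Lemma dfphase_ge0_le s : 0 <= dfphase s <= 15 / 8.
Proof.
rewrite /dfphase; case: ltrP => s0; first by lra.
case: ltrP => s1; last by lra.
have -> : 30 * s ^+ 2 * (1 - s) ^+ 2 = 30 * (s * (1 - s)) ^+ 2 by ring.
have h0 : 0 <= s * (1 - s) by rewrite mulr_ge0 // subr_ge0 ltW.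
have h1 : s * (1 - s) <= 1 / 4 by have := sqr_ge0 (s - 1 / 2); lra.
have h2 : (s * (1 - s)) ^+ 2 <= (1 / 4) ^+ 2 by rewrite lerXn2r ?nnegrE //; lra.
by apply/andP; split; [have := sqr_ge0 (s * (1 - s)) | move: h2]; lra.
Qed.

(* At s = 1/2 the slope of f is maximal; difference quotients centred there
   recover it in the limit. *)
Lemma fphase_lipschitz_ge (Lp : R) : Lp.-lipschitz (@fphase R) -> 15 / 8 <= Lp.
Proof.
move=> hL; rewrite leNgt; apply/negP => hlt.
have L0 : 0 <= Lp.
  have := hL (1, 0) (conj I I); rewrite /= subr0 normr1 mulr1.
  exact: le_trans (normr_ge0 _).
(* The quotient between (1 - x)/2 and (1 + x)/2 is 15/8 (1 - 2/3 x^2 + x^4/5); the last term is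
   dropped. *)
have key (x : R) : 0 < x -> x < 1 -> 15 / 8 * (1 - 2 / 3 * x ^+ 2) <= Lp.
  move=> x0 x1; have := hL ((1 + x) / 2, (1 - x) / 2) (conj I I).
  have E (t : R) : 0 <= t -> t < 1 ->
      fphase t = 6 * t ^+ 5 - 15 * t ^+ 4 + 10 * t ^+ 3.
    by move=> t0 t1; rewrite fphaseE ltNge t0 t1.
  rewrite /= !E; try lra.
  have -> : (1 + x) / 2 - (1 - x) / 2 = x by field.
  rewrite (gtr0_norm x0) => /(le_trans (ler_norm _)).
  set a := (X in X <= _); have -> : a = 15 / 8 * (1 - 2 / 3 * x ^+ 2 + x ^+ 4 / 5) * x.
    by rewrite /a; field.
  rewrite ler_pM2r //; have := exprn_ge0 4 (ltW x0); lra.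
(* With x = e/2, [key] loses 5/16 e^2, at most 75/128 e since e <= 15/8. This is less than the
   assumed gap e, a contradiction. *)
pose e : R := 15 / 8 - Lp.
have e1 : e <= 15 / 8 by rewrite /e; lra.
have e0 : 0 < e by rewrite /e; lra.
have h1 : (e / 2) ^+ 2 <= e / 2 * (15 / 16).
  by rewrite expr2 ler_wpM2l //; lra.
have h2 : 15 / 8 * (1 - 2 / 3 * (e / 2) ^+ 2) <= Lp by apply: key; lra.
by rewrite /e in h1 h2 e0; lra.
Qed.

(* The weight 81/65 is 1/(1 - t^2) for t = 4/9, and 5/6 = 15/8 * t is the value
   of f' at the inflection points of f', where |f''| is maximal: both sides
   vanish there to second order. *)
Lemma dfphase_ddfphase_aux w y : 0 < w -> w ^+ 2 = 3^-1 -> 0 <= y <= 1 ->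
  81 / 65 * (15 / 8 * (1 - y ^+ 2) ^+ 2 - 5 / 6) ^+ 2
    <= 1 / 2 * (10 * w - 15 * y * (1 - y ^+ 2)).
Proof.
move=> w0 w2 /andP[y0 y1].
have w3 : w ^+ 3 = 3^-1 * w by rewrite exprSr w2.
(* A rational upper bound for 1/sqrt 3, tight enough for the final linear comparison. *)
have w1 : w <= 37 / 64.
  rewrite leNgt; apply/negP => h.
  have : 0 < (w - 37 / 64) * (w + 37 / 64) by apply: mulr_gt0; lra.
  by lra.
(* The left side contains (1 - y^2)^2 - 4/9 = (w^2 - y^2)(5/3 - y^2) = (w - y) p. Both sides then
   carry the factor (w - y)^2, and only a bound on p^2 remains. *)
pose p := (w + y) * (5 / 3 - y ^+ 2).
have y2 : y ^+ 2 <= 1 by rewrite exprn_ile1.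
have y2' : 0 <= y ^+ 2 by rewrite sqr_ge0.
have p0 : 0 <= p by rewrite mulr_ge0 //; lra.
have p1 : p <= 8 / 3 * w.
  have : 0 <= (y - w) ^+ 2 * (y + 3 * w).
    by rewrite mulr_ge0 ?sqr_ge0 //; lra.
  have -> : (y - w) ^+ 2 * (y + 3 * w)
      = y ^+ 3 + w * y ^+ 2 - 5 * w ^+ 2 * y + 3 * w ^+ 3 by ring.
  by rewrite /p w3 w2; lra.
have p2 : p <= 5 / 3 * (w + y).
  rewrite /p mulrC ler_wpM2r //; lra.
(* One factor is bounded by [p1], the other by the average of [p1] and [p2], so that p^2 is compared
   with a linear form in w and y. *)
have p3 : p ^+ 2 <= 8 / 3 * w * (13 / 6 * w + 5 / 6 * y).
  by rewrite expr2 ler_pM //; lra.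
have -> : 15 / 8 * (1 - y ^+ 2) ^+ 2 - 5 / 6 = 15 / 8 * ((w - y) * p).
  have -> : (w - y) * p = (w ^+ 2 - y ^+ 2) * (5 / 3 - y ^+ 2) by rewrite /p; ring.
  by rewrite w2; field.
have -> : 10 * w - 15 * y * (1 - y ^+ 2) = 15 * ((w - y) ^+ 2 * (y + 2 * w)).
  have -> : (w - y) ^+ 2 * (y + 2 * w) = y ^+ 3 - 3 * w ^+ 2 * y + 2 * w ^+ 3 by ring.
  by rewrite w3 w2; field.
have -> : 81 / 65 * (15 / 8 * ((w - y) * p)) ^+ 2
  = (w - y) ^+ 2 * (81 / 65 * (225 / 64) * p ^+ 2) by field.
have -> : 1 / 2 * (15 * ((w - y) ^+ 2 * (y + 2 * w)))
  = (w - y) ^+ 2 * (15 / 2 * (y + 2 * w)) by field.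
rewrite ler_wpM2l ?sqr_ge0 //.
have : w * (13 / 6 * w + 5 / 6 * y) <= 37 / 64 * (13 / 6 * w + 5 / 6 * y).
  by rewrite ler_wpM2r //; lra.
lra.
Qed.

(** About s = 1/2 the first derivative is even and the second odd, so on [0, 1) everything depends
    on y = |2s - 1| and [dfphase_ddfphase_aux] applies. *)
Lemma dfphase_ddfphase (Lf : R) s :
    (forall s : R, `|derive1n 2 (@fphase R) s| <= Lf) ->
  81 / 65 * (dfphase s - 5 / 6) ^+ 2 <= 1 / 2 * (Lf - `|ddfphase s|).
Proof.
rewrite (derive1n2 is_derive_fphase is_derive_dfphase) => hL.
pose w : R := Num.sqrt 3^-1.
have w0 : 0 < w by rewrite sqrtr_gt0; lra.
have w2 : w ^+ 2 = 3^-1 by rewrite sqr_sqrtr //; lra.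
have w1 : w < 1.
  rewrite ltNge; apply/negP => h.
  have : 0 <= (w - 1) * (w + 1) by apply: mulr_ge0; lra.
  by lra.
(* This serves outside [0, 1), where both derivatives vanish and the left side is the constant
   45/52: it gives Lf >= 5. *)
have wl : 1 / 2 <= w.
  rewrite leNgt; apply/negP => h.
  have : 0 < (1 / 2 - w) * (w + 1 / 2) by apply: mulr_gt0; lra.
  by lra.
(* The bound on the second derivative is evaluated at its maximum point (1 - w)/2. *)
have L10 : 10 * w <= Lf.
  apply: le_trans (hL ((1 - w) / 2)); apply: le_trans (ler_norm _).
  rewrite /ddfphase ifF; last by apply/negbTE; rewrite -leNgt; lra.
  rewrite ifT; last by lra.
  have -> : 60 * ((1 - w) / 2) * (1 - (1 - w) / 2) * (1 - 2 * ((1 - w) / 2))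
     = 15 * w * (1 - w ^+ 2) by field.
  by rewrite w2; lra.
rewrite /dfphase /ddfphase; case: ltrP => s0; first by rewrite normr0 !expr2; lra.
case: ltrP => s1; last by rewrite normr0 !expr2; lra.
pose x := 2 * s - 1.
have -> : 30 * s ^+ 2 * (1 - s) ^+ 2 = 15 / 8 * (1 - `|x| ^+ 2) ^+ 2.
  by rewrite real_normK ?num_real // /x; field.
have -> : `|60 * s * (1 - s) * (1 - 2 * s)| = 15 * `|x| * (1 - `|x| ^+ 2).
  have -> : 60 * s * (1 - s) * (1 - 2 * s) = (15 * (1 - x ^+ 2)) * (- x).
    by rewrite /x; ring.
  rewrite normrM normrN ger0_norm; first by rewrite real_normK ?num_real //; ring.
  have -> : 1 - x ^+ 2 = 4 * (s * (1 - s)) by rewrite /x; ring.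
  by rewrite !mulr_ge0 //; lra.
have x01 : 0 <= `|x| <= 1 by rewrite normr_ge0 ler_norml /x; lra.
have := dfphase_ddfphase_aux w0 w2 x01; lra.
Qed.

End NonlinearityBounds.

(** * Bilinear forms of kernels on a finite index set *)

Section BilinearForm.
Context {R : realType} {I : finType}.
Implicit Types (J K : I -> I -> R) (a c d e g h : I -> R).

Definition bilin K g h : R := \sum_p \sum_q K p q * (g p * h q).

Lemma bilinC K g h : (forall p q, K p q = K q p) -> bilin K g h = bilin K h g.
Proof.
move=> sK; rewrite /bilin exchange_big; apply: eq_bigr => p _.
by apply: eq_bigr => q _; rewrite sK [h p * _]mulrC.
Qed.

Lemma bilin_comb K g h (x y : R) : (forall p q, K p q = K q p) ->
  bilin K (fun p => x * g p + y * h p) (fun p => x * g p + y * h p)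
    = x ^+ 2 * bilin K g g + 2 * x * y * bilin K g h + y ^+ 2 * bilin K h h.
Proof.
move=> sK.
have -> : 2 * x * y * bilin K g h = x * y * bilin K g h + x * y * bilin K h g.
  by rewrite [bilin K h g]bilinC //; ring.
rewrite /bilin !mulr_sumr -!big_split; apply: eq_bigr => p _ /=.
rewrite !mulr_sumr -!big_split; apply: eq_bigr => q _ /=; ring.
Qed.

Lemma bilin_addK J K g h (x y : R) :
  bilin (fun p q => x * J p q + y * K p q) g h = x * bilin J g h + y * bilin K g h.
Proof.
rewrite /bilin !mulr_sumr -!big_split; apply: eq_bigr => p _ /=.
rewrite !mulr_sumr -!big_split; apply: eq_bigr => q _ /=; ring.
Qed.

(** This is the Schur test: |e_p e_q| is at most the mean of the squares, and symmetry turns column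
    sums into row sums. *)
Lemma bilin_le_rowsum K Lam e : (forall p q, K p q = K q p) ->
    (forall p, \sum_q `|K p q| <= Lam) ->
  bilin K e e <= Lam * \sum_p e p ^+ 2.
Proof.
move=> sK rs.
have : bilin K e e <= \sum_p \sum_q `|K p q| / 2 * (e p ^+ 2 + e q ^+ 2).
  apply: ler_sum => p _; apply: ler_sum => q _.
  have h : `|e p * e q| <= (e p ^+ 2 + e q ^+ 2) / 2.
    by rewrite ler_norml; have := sqr_ge0 (e p - e q); have := sqr_ge0 (e p + e q); lra.
  apply: le_trans (ler_norm _) _; rewrite normrM -mulrA ler_wpM2l //.
  by rewrite [2^-1 * _]mulrC.
move/le_trans; apply.
have -> : \sum_p \sum_q `|K p q| / 2 * (e p ^+ 2 + e q ^+ 2)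
    = \sum_p (\sum_q `|K p q|) * e p ^+ 2.
  have E : \sum_p (\sum_q `|K p q|) * e p ^+ 2 =
      \sum_p \sum_q `|K p q| / 2 * e p ^+ 2 + \sum_p \sum_q `|K p q| / 2 * e q ^+ 2.
    rewrite [X in _ = _ + X]exchange_big -big_split; apply: eq_bigr => p _ /=.
    rewrite mulr_suml -big_split; apply: eq_bigr => q _ /=.
    by rewrite [K q p]sK; field.
  rewrite E -big_split; apply: eq_bigr => p _.
  by rewrite -big_split; apply: eq_bigr => q _; rewrite mulrDr.
by rewrite mulr_sumr; apply: ler_sum => p _; rewrite ler_wpM2r ?sqr_ge0.
Qed.

(** Summing over the index of [a] first bounds each entry of K a by [Lam * mx]; what remains is the
    l^1 norm of [g]. *)
Lemma bilin_le_sup K Lam (mx : R) a g : (forall p q, K p q = K q p) ->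
    (forall p, \sum_q `|K p q| <= Lam) -> (forall p, `|a p| <= mx) ->
  bilin K a g <= Lam * mx * \sum_p `|g p|.
Proof.
move=> sK rs am; rewrite /bilin exchange_big mulr_sumr; apply: ler_sum => q _.
under eq_bigr do rewrite mulrA.
rewrite -mulr_suml; apply: le_trans (ler_norm _) _.
rewrite normrM ler_wpM2r //.
apply: le_trans (ler_norm_sum _ _ _) _.
have mx0 : 0 <= mx by exact: le_trans (am q).
apply: le_trans (ler_wpM2r mx0 (rs q)); rewrite mulr_suml.
by apply: ler_sum => p _; rewrite normrM sK ler_wpM2l.
Qed.

Lemma is_derive_bigsum (h : I -> R -> R) (dh : I -> R) (t : R) :
    (forall i, is_derive t 1 (h i) (dh i)) ->
  is_derive t 1 (fun t => \sum_i h i t) (\sum_i dh i).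
Proof.
move=> H; have -> : (fun t => \sum_i h i t) = \sum_i h i.
  by apply/funext => x; rewrite fct_sumE.
by elim/big_ind2 : _ => // [|*]; [exact: is_derive_cst | exact: is_deriveD].
Qed.

Lemma is_derive_bilin K (A B : I -> R -> R) a b (t : R) :
    (forall p, is_derive t 1 (A p) (a p)) ->
    (forall p, is_derive t 1 (B p) (b p)) ->
  is_derive t 1 (fun t => bilin K (A^~ t) (B^~ t))
    (bilin K a (B^~ t) + bilin K (A^~ t) b).
Proof.
move=> hA hB; rewrite /bilin -big_split; apply: is_derive_bigsum => p /=.
rewrite -big_split; apply: is_derive_bigsum => q /=.
have -> : (fun t => K p q * (A p t * B q t)) = K p q \*: (A p * B q) by [].
apply: is_derive_eq; rewrite /GRing.scale /=; ring.
Qed.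

End BilinearForm.

(** * Hessian and Taylor bounds for the nonlocal and mass terms *)

Section NonlocalEnergy.
Context {R : realType} {I : finType}.
Variables (K : I -> I -> R) (Lam Lp Lf mx : R).
Hypothesis symK : forall p q, K p q = K q p.
Hypothesis psdK : forall e, 0 <= bilin K e e.
Hypothesis rowK : forall p, \sum_q `|K p q| <= Lam.
Hypothesis Lam_ge0 : 0 <= Lam.
Hypothesis Lp_ge : 15 / 8 <= Lp.
Hypothesis Lf_ge : forall s : R, `|derive1n 2 (@fphase R) s| <= Lf.
Hypothesis mx_ge : 1 / 2 <= mx.
Implicit Types (a d s u : I -> R).

Let b s d p := dfphase (s p) * d p.
Let c s d p := ddfphase (s p) * d p * d p.

Let ddf_le (s : R) : `|ddfphase s| <= Lf.
Proof.
by have := Lf_ge s; rewrite (derive1n2 is_derive_fphase is_derive_dfphase).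
Qed.

Lemma hessian_le a s d : (forall p, `|a p| <= mx) ->
  bilin K (b s d) (b s d) + bilin K a (c s d)
    <= Lp ^+ 2 * bilin K d d + Lam * mx * Lf * \sum_p d p ^+ 2.
Proof.
move=> am; pose e p := (dfphase (s p) - 5 / 6) * d p.
have bE : b s d = fun p => 5 / 6 * d p + 1 * e p.
  by apply/funext => p; rewrite /b /e; ring.
(* Up to the factor 1625/576 = 225/64 - 25/36, this square is 225/64 <K d, d> + 81/65 <K e, e> - <K
   b, b> with b = 5/6 d + e. *)
have := psdK (fun p => 1625 / 576 * d p + (- (5 / 6)) * e p).
rewrite bE !(bilin_comb _ _ _ _ symK) => h1.
have h2 : 225 / 64 * bilin K d d <= Lp ^+ 2 * bilin K d d.
  rewrite ler_wpM2r // (_ : 225 / 64 = (15 / 8) ^+ 2); last by field.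
  by rewrite lerXn2r ?nnegrE //; have := Lp_ge; lra.
(* The Schur test reduces this to the pointwise inequality, whose factor 1/2 is then enlarged to
   [mx]. *)
have h3 : 81 / 65 * bilin K e e
    <= Lam * mx * \sum_p (Lf - `|ddfphase (s p)|) * d p ^+ 2.
  have : 81 / 65 * bilin K e e <= 81 / 65 * (Lam * \sum_p e p ^+ 2).
    by rewrite ler_wpM2l ?bilin_le_rowsum //; lra.
  move/le_trans; apply.
  rewrite mulrCA -mulrA ler_wpM2l // !mulr_sumr; apply: ler_sum => p _.
  rewrite /e exprMn mulrA [leRHS]mulrA ler_wpM2r ?sqr_ge0 //.
  apply: le_trans (dfphase_ddfphase (s p) Lf_ge) _.
  by rewrite ler_wpM2r // subr_ge0.
have h4 : bilin K a (c s d) <= Lam * mx * \sum_p `|ddfphase (s p)| * d p ^+ 2.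
  apply: le_trans (bilin_le_sup (c s d) symK rowK am) _.
  rewrite le_eqVlt; apply/orP; left; apply/eqP; congr (_ * _).
  by apply: eq_bigr => p _; rewrite /c -mulrA normrM -expr2 normrX real_normK ?num_real.
have h5 : \sum_p (Lf - `|ddfphase (s p)|) * d p ^+ 2
    = Lf * (\sum_p d p ^+ 2) - \sum_p `|ddfphase (s p)| * d p ^+ 2.
  by rewrite mulr_sumr -sumrB; apply: eq_bigr => p _; rewrite mulrBl.
rewrite h5 mulrBr mulrA in h3.
lra.
Qed.

(** The counterpart for the mass penalty, whose kernel is constant with row sums #|I|. Here the two
    Hessian terms are estimated separately. *)
Lemma mean_hessian_le a s d : (forall p, `|a p| <= mx) ->
  bilin (fun _ _ => 1) (b s d) (b s d) + bilin (fun _ _ => 1) a (c s d)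
    <= #|I|%:R * (Lp ^+ 2 + mx * Lf) * \sum_p d p ^+ 2.
Proof.
move=> am.
have mx0 : 0 <= mx by have := mx_ge; lra.
have row1 (p : I) : \sum_(q : I) `|(1 : R)| <= #|I|%:R.
  by rewrite normr1 sumr_const.
have n0 : (0 : R) <= #|I|%:R by [].
have h1 : bilin (fun _ _ => 1) (b s d) (b s d)
    <= #|I|%:R * (Lp ^+ 2 * \sum_p d p ^+ 2).
  apply: le_trans (@bilin_le_rowsum _ _ _ _ _ _ row1) _ => //.
  rewrite ler_wpM2l // mulr_sumr; apply: ler_sum => p _.
  rewrite /b exprMn ler_wpM2r ?sqr_ge0 //.
  have {row1} /andP[l0 l1] := dfphase_ge0_le (s p).
  by rewrite lerXn2r ?nnegrE //; have := Lp_ge; lra.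
have h2 : bilin (fun _ _ => 1) a (c s d)
    <= #|I|%:R * mx * (Lf * \sum_p d p ^+ 2).
  apply: le_trans (@bilin_le_sup _ _ _ _ _ _ (c s d) _ row1 am) _ => //.
  rewrite ler_wpM2l ?mulr_ge0 // mulr_sumr; apply: ler_sum => p _.
  by rewrite /c -mulrA -expr2 normrM [`|_ ^+ 2|]ger0_norm ?sqr_ge0 // ler_wpM2r ?sqr_ge0.
move=> {row1}; lra.
Qed.

(** The constant kernel encodes the squared mass defect, so a single quadratic form covers both
    terms of the energy in f - omega. *)
Definition nonlocal_kernel (gam mu : R) (p q : I) : R := gam * K p q + mu * 1.

Definition defect (omega : R) u (p : I) : R := fphase (u p) - omega.

Lemma nonlocal_taylor_le (gam mu omega : R) u d : 0 <= gam -> 0 <= mu ->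
    omega <= mx -> 1 - omega <= mx ->
  bilin (nonlocal_kernel gam mu) (defect omega (fun p => u p + d p))
      (defect omega (fun p => u p + d p)) / 2
    <= bilin (nonlocal_kernel gam mu) (defect omega u) (defect omega u) / 2
     + bilin (nonlocal_kernel gam mu) (defect omega u) (fun p => dfphase (u p) * d p)
     + (gam * (Lp ^+ 2 * bilin K d d + Lam * mx * Lf * \sum_p d p ^+ 2)
        + mu * (#|I|%:R * (Lp ^+ 2 + mx * Lf) * \sum_p d p ^+ 2)) / 2.
Proof.
move=> gam0 mu0 om1 om2.
set J := nonlocal_kernel gam mu; set a := defect omega.
have symJ p q : J p q = J q p by rewrite /J /nonlocal_kernel symK.
pose s t p := u p + t * d p.
pose A p t := fphase (s t p) - omega.
pose B p t := b (s t) d p.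
have dA p (t : R) : is_derive t 1 (A p) (B p t).
  have h := is_derive_line (u p) (d p) t is_derive_fphase.
  have -> : A p = (fun t => fphase (s t p)) - cst omega by [].
  by apply: is_derive_eq; rewrite subr0.
have dB p (t : R) : is_derive t 1 (B p) (c (s t) d p).
  have h := is_derive_line (u p) (d p) t is_derive_dfphase.
  have -> : B p = d p \*: (fun t => dfphase (s t p)).
    by apply/funext => x; rewrite /B /b /GRing.scale_fun /= mulrC.
  by apply: is_derive_eq; rewrite /GRing.scale /= mulrC.
(* Since f takes values in [0, 1], this holds along the whole segment, whatever the size of [u] and
   [d]. *)
have Am p t : `|A p t| <= mx.
  by have := fphase_ge0_le1 (s t p); rewrite /A ler_norml; lra.
have d1 (t : R) : is_derive t 1 (fun t => bilin J (A^~ t) (A^~ t) / 2)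
    (bilin J (A^~ t) (B^~ t)).
  have h := @is_derive_bilin _ _ J A A (B^~ t) (B^~ t) t (dA^~ t) (dA^~ t).
  have -> : (fun t => bilin J (A^~ t) (A^~ t) / 2)
      = 2^-1 \*: (fun t => bilin J (A^~ t) (A^~ t)).
    by apply/funext => x; rewrite /GRing.scale_fun /= mulrC.
  by apply: is_derive_eq; rewrite [bilin J (B^~ t) _]bilinC // /GRing.scale /=; field.
have d2 (t : R) : is_derive t 1 (fun t => bilin J (A^~ t) (B^~ t))
    (bilin J (B^~ t) (B^~ t) + bilin J (A^~ t) (c (s t) d)).
  exact: (@is_derive_bilin _ _ J A B (B^~ t) (c (s t) d) t (dA^~ t) (dB^~ t)).
have := taylor2_le d1 d2.
have -> : A^~ 1 = a (fun p => u p + d p).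
  by apply/funext => p; rewrite /A /a /defect /s mul1r.
have -> : A^~ 0 = a u.
  by apply/funext => p; rewrite /A /a /defect /s mul0r addr0.
have -> : B^~ 0 = fun p => dfphase (u p) * d p.
  by apply/funext => p; rewrite /B /b /s mul0r addr0.
apply=> t.
rewrite /J /nonlocal_kernel !bilin_addK.
have := ler_wpM2l gam0 (hessian_le (s t) d (Am^~ t)).
have := ler_wpM2l mu0 (mean_hessian_le (s t) d (Am^~ t)).
rewrite -/(B^~ t); lra.
Qed.

End NonlocalEnergy.

(** * Energy decay for an abstract stabilised scheme *)

Section GradientFlow.
Context {R : realType} {I : finType}.
Implicit Types (d g u : I -> R).

Definition act (K : I -> I -> R) g (p : I) : R := \sum_q K p q * g q.

Lemma bilin_act (K : I -> I -> R) g h :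
  bilin K g h = \sum_p g p * act K h p.
Proof.
apply: eq_bigr => p _; rewrite mulr_sumr; apply: eq_bigr => q _; ring.
Qed.

Variables (L K : I -> I -> R) (Lam Lp Lf mx LW : R) (W dW : R -> R).
Hypothesis symL : forall p q, L p q = L q p.
Hypothesis psdL : forall e, 0 <= bilin L e e.
Hypothesis symK : forall p q, K p q = K q p.
Hypothesis psdK : forall e, 0 <= bilin K e e.
Hypothesis rowK : forall p, \sum_q `|K p q| <= Lam.
Hypothesis Lam_ge0 : 0 <= Lam.
Hypothesis Lp_ge : 15 / 8 <= Lp.
Hypothesis Lf_ge : forall s : R, `|derive1n 2 (@fphase R) s| <= Lf.
Hypothesis mx_ge : 1 / 2 <= mx.
Hypothesis W_le : forall s t, W (s + t) <= W s + dW s * t + LW / 2 * t ^+ 2.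
Variables (eps gam mu omega kappa beta tau : R).
Hypotheses (eps_gt0 : 0 < eps) (gam_ge0 : 0 <= gam) (mu_ge0 : 0 <= mu).
Hypotheses (om1 : omega <= mx) (om2 : 1 - omega <= mx) (tau_gt0 : 0 < tau).
Hypothesis beta_ge : Lp ^+ 2 / 2 <= beta.
Hypothesis kappa_ge : LW / 2 + eps * (gam * Lf / 2 * Lam * mx
  + mu / 2 * #|I|%:R * (Lp ^+ 2 + Lf * mx)) <= kappa.

Let J := nonlocal_kernel K gam mu.

Definition kernel_energy u : R :=
  eps / 2 * bilin L u u + eps^-1 * (\sum_p W (u p))
  + bilin J (defect omega u) (defect omega u) / 2.

Lemma kernel_energy_decay u v :
    (forall p, (v p - u p) / tau = - eps * act L v p
       - kappa / eps * (v p - u p) - gam * beta * act K (fun q => v q - u q) p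
       - eps^-1 * dW (u p) - act J (defect omega u) p * dfphase (u p)) ->
  kernel_energy v <= kernel_energy u.
Proof.
move=> scheme; pose d p := v p - u p.
have vE : v = fun p => u p + d p by apply/funext => p; rewrite /d; ring.
pose S := \sum_p d p ^+ 2.
have S0 : 0 <= S by apply: sumr_ge0 => p _; exact: sqr_ge0.
have test : S / tau = - eps * bilin L d v - kappa / eps * S
    - gam * beta * bilin K d d - eps^-1 * (\sum_p dW (u p) * d p)
    - bilin J (defect omega u) (fun p => dfphase (u p) * d p).
  rewrite [X in _ - X]bilinC; last by move=> p q; rewrite /J /nonlocal_kernel symK.
  rewrite !bilin_act /S !mulr_suml !mulr_sumr -!sumrB.
  apply: eq_bigr => p _; have := congr1 ( *%R (d p)) (scheme p).
  rewrite -/(d p) => E; rewrite expr2 -mulrA E -/d; ring.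
have hW : \sum_p W (v p) <= \sum_p W (u p) + \sum_p dW (u p) * d p + LW / 2 * S.
  rewrite /S mulr_sumr -!big_split; apply: ler_sum => p _ /=.
  by have := W_le (u p) (d p); rewrite vE.
(* Convexity of the quadratic form at the new iterate [v], matching the implicit treatment of [L] in
   the scheme. *)
have hL : bilin L v v <= bilin L u u + 2 * bilin L d v.
  have uE : u = fun p => 1 * v p + (- 1) * d p by apply/funext => p; rewrite /d; ring.
  have -> : bilin L u u = bilin L v v - 2 * bilin L d v + bilin L d d.
    by rewrite uE (bilin_comb _ _ _ _ symL) [bilin L v d]bilinC //; ring.
  by have := psdL d; lra.
have hN := nonlocal_taylor_le symK psdK rowK Lam_ge0 Lp_ge Lf_ge mx_ge
  u d gam_ge0 mu_ge0 om1 om2.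
rewrite -vE -/J -/S in hN.
(* After division by [eps], the bound on [kappa] pays for the remainder in [hW] and for the multiple
   of [S] in [hN]; the multiple of [bilin K d d] in [hN] is left to [beta]. *)
have kS : (LW / 2 + eps * (gam * Lf / 2 * Lam * mx
  + mu / 2 * #|I|%:R * (Lp ^+ 2 + Lf * mx))) / eps * S <= kappa / eps * S.
  by rewrite ler_wpM2r // ler_wpM2r // invr_ge0 ltW.
have kE : (LW / 2 + eps * (gam * Lf / 2 * Lam * mx
  + mu / 2 * #|I|%:R * (Lp ^+ 2 + Lf * mx))) / eps * S
  = eps^-1 * (LW / 2 * S) + (gam * Lf / 2 * Lam * mx
  + mu / 2 * #|I|%:R * (Lp ^+ 2 + Lf * mx)) * S.
  by field; rewrite gt_eqF.
rewrite kE in kS.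
have bS : gam * (Lp ^+ 2 / 2) * bilin K d d <= gam * beta * bilin K d d.
  by rewrite ler_wpM2r // ler_wpM2l.
have tS : 0 <= S / tau by rewrite divr_ge0 // ltW.
have hW' : eps^-1 * (\sum_p W (v p)) <= eps^-1 *
    (\sum_p W (u p) + \sum_p dW (u p) * d p + LW / 2 * S).
  by rewrite ler_wpM2l // invr_ge0 ltW.
have hL' : eps / 2 * bilin L v v <= eps / 2 * (bilin L u u + 2 * bilin L d v).
  by rewrite ler_wpM2l // divr_ge0 // ltW.
rewrite /kernel_energy; lra.
Qed.

End GradientFlow.

(** * Fourier multipliers as symmetric kernels on one period *)

Section DiscreteFourier.
Context {R : realType}.
Variables (X Y : R) (Nx Ny : nat).
Hypotheses (X0 : X != 0) (Y0 : Y != 0) (Nx0 : (0 < Nx)%N) (Ny0 : (0 < Ny)%N).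
Hypotheses (evenNx : ~~ odd Nx) (evenNy : ~~ odd Ny).
Implicit Types (mu : int -> int -> R) (g : int -> int -> R).

Local Notation C := R[i].
Local Notation I := ('I_Nx * 'I_Ny)%type.

(** Ordinals start at 0 and grid indices at 1, hence the successors; [freq] also shifts by half a
    period to enumerate the frequency window. *)
Definition restr (T : Type) (g : int -> int -> T) (p : I) : T :=
  g (p.1.+1)%:Z (p.2.+1)%:Z.

Definition freq (T : Type) (u : int -> int -> T) (q : I) : T :=
  u ((q.1.+1)%:Z - (Nx./2)%:Z) ((q.2.+1)%:Z - (Ny./2)%:Z).

Lemma sumSE (V : nmodType) (F : int -> int -> V) : sumS Nx Ny F = \sum_p restr F p.
Proof.
rewrite /sumS big_add1 big_mkord /=.
under eq_bigr do rewrite big_add1 big_mkord /=.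
by rewrite pair_big.
Qed.

Lemma sumhatSE (V : nmodType) (F : int -> int -> V) :
  sumhatS Nx Ny F = \sum_q freq F q.
Proof. by rewrite /sumhatS sumSE. Qed.

Definition angle (k l i j : int) : R :=
  k%:~R * pi * xgrid X Nx i / X + l%:~R * pi * ygrid Y Ny j / Y.

Lemma idft_angle (u : int -> int -> C) i j : idft X Y Nx Ny u i j =
  \sum_q freq (fun k l => u k l * expi (angle k l i j)) q.
Proof.
rewrite /idft sumhatSE; apply: eq_bigr => q _.
by rewrite /freq /angle expiD mulrA.
Qed.

Lemma dft_angle (u : int -> int -> C) k l : dft X Y Nx Ny u k l =
  (Nx * Ny)%:R^-1 * \sum_p restr (fun i j => u i j * expi (- angle k l i j)) p.
Proof.
rewrite /dft sumSE; congr (_ * _); apply: eq_bigr => q _.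
by rewrite /restr /angle opprD expiD mulrA.
Qed.

Lemma Re_sum (J : finType) (F : J -> C) :
  complex.Re (\sum_j F j) = \sum_j complex.Re (F j).
Proof. by elim/big_rec2: _ => // j x z _ <-; case: (F j) z => a b []. Qed.

Lemma Re_realM (x : R) (z : C) : complex.Re (x%:C%C * z) = x * complex.Re z.
Proof. by case: z => a b /=; rewrite mul0r subr0. Qed.

Lemma natC (n : nat) : (n%:R : C) = (n%:R : R)%:C%C.
Proof. by rewrite rmorph_nat. Qed.

(** The real part taken in [fmult] leaves only the cosine of the exponential, hence a real symmetric
    kernel for any real symbol. *)
Definition fkern mu (p q : I) : R := (Nx * Ny)%:R^-1 *
  \sum_r freq (fun k l => mu k l * cos (restr (angle k l) p - restr (angle k l) q)) r.

Lemma fkernC mu p q : fkern mu p q = fkern mu q p.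
Proof.
congr (_ * _); apply: eq_bigr => r _; rewrite /freq.
by rewrite -[in LHS]cosN opprB.
Qed.

Lemma fmult_fkern mu g p :
  restr (fmult X Y Nx Ny mu g) p = act (fkern mu) (restr g) p.
Proof.
rewrite /restr /fmult idft_angle Re_sum /act /fkern.
under [RHS]eq_bigr do rewrite mulrAC mulr_sumr.
rewrite exchange_big /=; apply: eq_bigr => r _.
rewrite /freq dft_angle natC -fmorphV mulrA -rmorphM -mulrA Re_realM.
rewrite mulr_suml Re_sum mulr_sumr; apply: eq_bigr => q _.
rewrite /restr /toC -mulrA -expiD Re_realM /= [- _ + _]addrC; ring.
Qed.

Definition sqnormc (z : C) : R := Normc.normc z ^+ 2.

Lemma sqnormcE (z : C) : (sqnormc z)%:C%C = z * z^*%C.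
Proof. by rewrite -sqr_normc /sqnormc rmorphXn; case: z. Qed.

Lemma sqnormcM (z t : C) : sqnormc (z * t) = sqnormc z * sqnormc t.
Proof. by rewrite /sqnormc Normc.normcM exprMn. Qed.

Lemma sqnormc_real (x : R) : sqnormc x%:C%C = x ^+ 2.
Proof. by rewrite /sqnormc /= expr0n addr0 sqr_sqrtr ?sqr_ge0. Qed.

Lemma sqnormc_imag (x : R) : sqnormc (0 +i* x)%C = x ^+ 2.
Proof. by rewrite /sqnormc /= expr0n add0r sqr_sqrtr ?sqr_ge0. Qed.

(** Stated for complex coefficients, because the gradient components need not be real at the Nyquist
    frequencies. *)
Lemma parseval (u : int -> int -> C) :
  \sum_p sqnormc (restr (idft X Y Nx Ny u) p)
    = (Nx * Ny)%:R * \sum_q sqnormc (freq u q).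
Proof.
apply: complexI; rewrite rmorphM !rmorph_sum /= -natC.
under eq_bigr do rewrite sqnormcE.
under [in RHS]eq_bigr do rewrite sqnormcE.
pose z := idft X Y Nx Ny u.
transitivity (\sum_p \sum_q restr z p * ((freq u q)^*%C *
   expi (- freq (fun k l => restr (angle k l) p) q))).
  apply: eq_bigr => p _; rewrite -mulr_sumr; congr (_ * _).
  rewrite {1}/restr idft_angle rmorph_sum; apply: eq_bigr => q _ /=.
  by rewrite /freq conjM conj_expi.
rewrite exchange_big mulr_sumr; apply: eq_bigr => q _ /=.
(* Only the unconjugated factor is rewritten: the sum over [p] is then recognised as the forward
   transform of [z]. *)
have {2}-> : freq u q = freq (dft X Y Nx Ny z) q.
  rewrite /freq /z dft_idft //; case: q => -[a ha] [b hb] /=; lia.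
rewrite /freq dft_angle mulrA [_%:R * _]mulrA divff ?mul1r; last first.
  by rewrite pnatr_eq0 muln_eq0 negb_or -!lt0n Nx0 Ny0.
by rewrite mulr_suml; apply: eq_bigr => p _; rewrite /restr; ring.
Qed.

Lemma conj_dft g k l : \sum_p (restr g p)%:C%C * expi (restr (angle k l) p)
  = (Nx * Ny)%:R * ((dft X Y Nx Ny (toC g) k l)^*)%C.
Proof.
rewrite dft_angle conjM natC -fmorphV conjc_real mulrA -rmorphM divff; last first.
  by rewrite pnatr_eq0 muln_eq0 negb_or -!lt0n Nx0 Ny0.
rewrite mul1r rmorph_sum; apply: eq_bigr => p _.
by rewrite -[RHS]/((_ * _)^*)%C conjM conj_expi opprK conjc_real.
Qed.

(** The Fourier basis diagonalises the kernel: for real [g], summing against the exponentials yields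
    the conjugate coefficient, by [conj_dft]. *)
Lemma bilin_fkern mu g : bilin (fkern mu) (restr g) (restr g) =
  (Nx * Ny)%:R * \sum_q freq mu q * sqnormc (freq (dft X Y Nx Ny (toC g)) q).
Proof.
rewrite bilin_act.
under eq_bigr do rewrite -fmult_fkern /restr /fmult idft_angle Re_sum mulr_sumr.
rewrite exchange_big mulr_sumr; apply: eq_bigr => q _ /=.
rewrite /freq; set k := (_ - _ : int); set l := (_ - _ : int).
have := congr1 (fun z => mu k l * complex.Re (z * dft X Y Nx Ny (toC g) k l))
  (conj_dft g k l).
rewrite -mulrA [_^*%C * _]mulrC -sqnormcE natC -rmorphM /= => E.
rewrite [RHS]mulrCA -{}E mulr_suml Re_sum mulr_sumr; apply: eq_bigr => p _.
move: (dft X Y Nx Ny (toC g) k l) => D.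
rewrite -!mulrA !Re_realM [expi _ * _]mulrC /restr; ring.
Qed.

Lemma fkern_psd mu : (forall q : I, 0 <= freq mu q) ->
  forall e : I -> R, 0 <= bilin (fkern mu) e e.
Proof.
move=> mu0 e.
(* The vector is extended by zero; the transform reads values on one period only. *)
pose g (i j : int) := \sum_(p : I | ((p.1.+1)%:Z == i) && ((p.2.+1)%:Z == j)) e p.
have <- : restr g = e.
  by apply/funext => p; rewrite /restr /g (big_pred1 p).
rewrite bilin_fkern mulr_ge0 // sumr_ge0 // => q _.
by rewrite mulr_ge0 ?sqr_ge0.
Qed.

Lemma freq_symb_ge0 (q : I) : 0 <= freq (symb X Y) q.
Proof. by rewrite addr_ge0 ?sqr_ge0. Qed.

Definition invsymb (k l : int) : R :=
  if (k == 0) && (l == 0) then 0 else (symb X Y k l)^-1.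

Lemma freq_invsymb_ge0 (q : I) : 0 <= freq invsymb q.
Proof. by rewrite /freq /invsymb; case: ifP => // _; rewrite invr_ge0 addr_ge0 ?sqr_ge0. Qed.

Lemma innerE g h : inner X Y Nx Ny g h =
  hx X Nx * hy Y Ny * \sum_p restr g p * restr h p.
Proof. by rewrite /inner sumSE. Qed.

(** This is discrete summation by parts: by Parseval the squared moduli of the two imaginary symbols
    add up to [symb], Nyquist modes included. *)
Lemma sqnorm_gradE g : sqnorm_grad X Y Nx Ny g =
  hx X Nx * hy Y Ny * bilin (fkern (symb X Y)) (restr g) (restr g).
Proof.
rewrite /sqnorm_grad sumSE big_split /= -!/(sqnormc _); congr (_ * _).
rewrite (parseval (fun k l => (0 +i* (k%:~R * pi / X))%C * dft X Y Nx Ny (toC g) k l)).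
rewrite (parseval (fun k l => (0 +i* (l%:~R * pi / Y))%C * dft X Y Nx Ny (toC g) k l)).
rewrite bilin_fkern -mulrDr -big_split; congr (_ * _); apply: eq_bigr => q _ /=.
by rewrite /freq !sqnormcM !sqnormc_imag -mulrDl.
Qed.

Lemma sqnormL2_invlap_halfE g : sqnormL2 X Y Nx Ny (invlap_half X Y Nx Ny g) =
  hx X Nx * hy Y Ny * bilin (fkern invsymb) (restr g) (restr g).
Proof.
rewrite /sqnormL2 innerE; congr (_ * _).
transitivity (\sum_p sqnormc (restr (toC (invlap_half X Y Nx Ny g)) p)).
  by apply: eq_bigr => p _; rewrite /restr /toC sqnormc_real.
rewrite toC_invlap_half // parseval bilin_fkern; congr (_ * _).
apply: eq_bigr => q _; rewrite {1}/freq sqnormcM sqnormc_real; congr (_ * _).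
rewrite /freq /invsymb; case: ifP => _; first by rewrite expr0n.
by rewrite sqr_sqrtr // invr_ge0 addr_ge0 ?sqr_ge0.
Qed.

Lemma lap_fkern g p :
  restr (lap X Y Nx Ny g) p = - act (fkern (symb X Y)) (restr g) p.
Proof.
rewrite lapE // fmult_fkern /act -sumrN; apply: eq_bigr => q _.
rewrite -mulNr; congr (_ * _); rewrite /fkern -mulrN -sumrN; congr (_ * _).
by apply: eq_bigr => r _; rewrite /freq mulNr.
Qed.

Lemma normLinf_ge g (p : I) : `|restr g p| <= normLinf Nx Ny g.
Proof.
rewrite /normLinf big_add1 big_mkord /=.
apply: le_trans (le_bigmax _ _ p.1).
by rewrite big_add1 big_mkord /=; apply: le_trans (le_bigmax _ _ p.2).
Qed.

Lemma normLinf_le g (c : R) : 0 <= c -> (forall p : I, `|restr g p| <= c) ->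
  normLinf Nx Ny g <= c.
Proof.
move=> c0 h; rewrite /normLinf big_add1 big_mkord /=; apply: bigmax_le => // i _.
by rewrite big_add1 big_mkord /=; apply: bigmax_le => // j _; exact: (h (i, j)).
Qed.

(** The operator is tested on the signs of row [p], whose image at [p] is the absolute row sum. *)
Lemma fkern_rowsum (p : I) :
  \sum_q `|fkern invsymb p q| <= opnorm_invlap X Y Nx Ny.
Proof.
pose g (i j : int) : R := if (i == (p.1.+1)%:Z) && (j == (p.2.+1)%:Z) then 1 else 0.
(* Applying the multiplier to a point mass produces the row, and its output is periodic even though
   [g] is not. *)
pose t (i j : int) := Num.sg (fmult X Y Nx Ny invsymb g i j).
have tE q : restr t q = Num.sg (fkern invsymb p q).
  rewrite -[restr t q]/(Num.sg (restr (fmult X Y Nx Ny invsymb g) q)).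
  rewrite fmult_fkern /act (bigD1 p) //= big1 => [|r rp].
    by rewrite addr0 /restr /g !eqxx mulr1 fkernC.
  rewrite /restr /g ifF ?mulr0 //; apply/negP => /andP[/eqP[e1] /eqP[e2]].
  move/eqP: rp; apply.
  by rewrite (surjective_pairing r) (surjective_pairing p) (ord_inj e1) (ord_inj e2).
have t1 : normLinf Nx Ny t <= 1.
  by apply: normLinf_le => // q; rewrite tE normr_sg; case: (_ != _).
have tM : Mh Nx Ny t.
  by move=> i j m n; rewrite /t (fmult_Mh X0 Y0 Nx0 Ny0).
apply: (@le_trans _ _ (normLinf Nx Ny (invlap X Y Nx Ny t))).
  apply: le_trans (normLinf_ge _ p); rewrite fmult_fkern /act.
  apply: le_trans (ler_norm _); apply: ler_sum => q _.
  by rewrite tE mulrC -normrEsg.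
apply: sup_ubound; last by exists t.
(* The supremum dominates its elements once the set is bounded; the sum of all absolute entries is a
   bound. *)
exists (\sum_r \sum_q `|fkern invsymb r q|) => _ [h [_ h1] <-].
apply: normLinf_le => [|r]; first by do 2!apply: sumr_ge0 => ? _.
rewrite fmult_fkern (bigD1 r) //=.
apply: le_trans (ler_norm_sum _ _ _) _.
apply: (@le_trans _ _ (\sum_q `|fkern invsymb r q|)).
  apply: ler_sum => q _; rewrite normrM ler_piMr //.
  exact: le_trans (normLinf_ge h q) h1.
by rewrite lerDl; do 2!apply: sumr_ge0 => ? _.
Qed.

End DiscreteFourier.

(** * The discrete energy in kernel form *)

Section DiscreteEnergy.
Context {R : realType}.
Variables (X Y : R) (Nx Ny : nat).
Hypotheses (X0 : 0 < X) (Y0 : 0 < Y) (Nx0 : (0 < Nx)%N) (Ny0 : (0 < Ny)%N).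
Hypotheses (evenNx : ~~ odd Nx) (evenNy : ~~ odd Ny).
Implicit Types (g phi : int -> int -> R).

Local Notation cell := (hx X Nx * hy Y Ny).

Lemma areaE : area X Y = cell * #|{: 'I_Nx * 'I_Ny}|%:R.
Proof.
rewrite card_prod !card_ord natrM /area /hx /hy; field.
by rewrite !pnatr_eq0 -!lt0n Nx0 Ny0.
Qed.

Lemma massE (omega : R) phi :
  inner X Y Nx Ny (gapp fphase phi) (gconst 1) - omega * area X Y
    = cell * \sum_(p : 'I_Nx * 'I_Ny) defect omega (restr phi) p.
Proof.
rewrite innerE areaE [omega * _]mulrCA -mulrBr; congr (_ * _).
rewrite /defect sumrB sumr_const mulr_natr; congr (_ - _).
by apply: eq_bigr => p _; rewrite /restr /gapp /gconst mulr1.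
Qed.

(** The squared mass defect carries the cell area twice; one factor stays in front and the other
    enters the coefficient [M * cell]. *)
Lemma energyE (eps gam M omega Mcut : R) phi :
  energy X Y Nx Ny eps gam M omega Mcut phi
    = cell * kernel_energy (@fkern _ X Y Nx Ny (symb X Y)) (@fkern _ X Y Nx Ny (invsymb X Y))
        (Wext Mcut) eps gam (M * cell) omega (restr phi).
Proof.
have [X1 Y1] : X != 0 /\ Y != 0 by rewrite !gt_eqF.
rewrite /energy massE sqnorm_gradE // sqnormL2_invlap_halfE // innerE.
rewrite /kernel_energy /nonlocal_kernel bilin_addK.
have -> : bilin (fun _ _ : 'I_Nx * 'I_Ny => 1) (defect omega (restr phi)) (defect omega (restr phi))
    = (\sum_(p : 'I_Nx * 'I_Ny) defect omega (restr phi) p) ^+ 2.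
  rewrite expr2 mulr_suml; apply: eq_bigr => p _; rewrite mulr_sumr.
  by apply: eq_bigr => q _; rewrite mul1r.
have -> : \sum_(p : 'I_Nx * 'I_Ny) restr (gapp (Wext Mcut) phi) p * restr (gconst 1) p
    = \sum_(p : 'I_Nx * 'I_Ny) Wext Mcut (restr phi p).
  by apply: eq_bigr => p _; rewrite /restr /gapp /gconst mulr1.
have -> : restr (gsub (gapp fphase phi) (gconst omega))
    = defect omega (restr phi) :> ('I_Nx * 'I_Ny -> R) by [].
lra.
Qed.

End DiscreteEnergy.

(** * Reduction of the discrete scheme to the abstract decay estimate *)

Theorem theorem3p1 (R : realType) (X Y : R) (hX : 0 < X) (hY : 0 < Y)
    (Nx Ny : nat) (hNx : (0 < Nx)%N) (hNy : (0 < Ny)%N)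
    (evenNx : ~~ odd Nx) (evenNy : ~~ odd Ny)
    (eps gam M omega Mcut : R) (heps : 0 < eps) (hgam : 0 < gam) (hM : 0 < M)
    (homega : 0 < omega < 1) (hMcut : 0 < Mcut)
    (LW Lf Lp : R)
    (hLW : forall s : R, `|derive1n 2 (Wext Mcut) s| <= LW)
    (hLf : forall s : R, `|derive1n 2 (@fphase R) s| <= Lf)
    (hLp : Lp.-lipschitz (@fphase R))
    (kappa beta : R)
    (hkappa : LW / 2
       + eps * (gam * Lf / 2 * opnorm_invlap X Y Nx Ny
                  * Num.max omega (1 - omega)
                + M / 2 * area X Y
                  * (Lp ^+ 2 + Lf * Num.max omega (1 - omega))) <= kappa)
    (hbeta : Lp ^+ 2 / 2 <= beta)
    (tau : R) (htau : 0 < tau)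
    (phi phi' : int -> int -> R)
    (hphi : Mh Nx Ny phi) (hphi' : Mh Nx Ny phi')
    (hscheme : scheme X Y Nx Ny eps gam M omega Mcut kappa beta tau phi phi') :
  energy X Y Nx Ny eps gam M omega Mcut phi'
    <= energy X Y Nx Ny eps gam M omega Mcut phi.
Proof.
have [X1 Y1] : X != 0 /\ Y != 0 by rewrite !gt_eqF.
have hx0 : 0 < hx X Nx by rewrite /hx divr_gt0 ?mulr_gt0 ?ltr0n.
have hy0 : 0 < hy Y Ny by rewrite /hy divr_gt0 ?mulr_gt0 ?ltr0n.
have /andP[om0 om1] := homega.
have cell0 : 0 < hx X Nx * hy Y Ny by exact: mulr_gt0.
rewrite !energyE // ler_pM2l //.
have rows := fkern_rowsum X1 Y1 hNx hNy.
have Lam0 : 0 <= opnorm_invlap X Y Nx Ny.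
  by apply: le_trans (rows (Ordinal hNx, Ordinal hNy)); exact: sumr_ge0.
have mx1 : omega <= Num.max omega (1 - omega) by rewrite le_max lexx.
have mx2 : 1 - omega <= Num.max omega (1 - omega) by rewrite le_max lexx orbT.
have symbP (e : 'I_Nx * 'I_Ny -> R) : 0 <= bilin (fkern X Y (symb X Y)) e e.
  by apply: fkern_psd => // q; exact: freq_symb_ge0.
have invP (e : 'I_Nx * 'I_Ny -> R) : 0 <= bilin (fkern X Y (invsymb X Y)) e e.
  by apply: fkern_psd => // q; exact: freq_invsymb_ge0.
have mx3 : 1 / 2 <= Num.max omega (1 - omega) by lra.
apply: (kernel_energy_decay (@fkernC _ X Y Nx Ny (symb X Y)) symbP
  (@fkernC _ X Y Nx Ny (invsymb X Y)) invP rows Lam0 (fphase_lipschitz_ge hLp)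
  hLf mx3 (fun s t => Wext_taylor_le s t hMcut hLW) heps (ltW hgam) _ mx1 mx2 htau
  hbeta).
- by apply: mulr_ge0; exact: ltW.
- apply: le_trans hkappa; rewrite (areaE X Y hNx hNy); lra.
move=> p; have := hscheme (p.1.+1)%:Z (p.2.+1)%:Z.
have invE g : invlap X Y Nx Ny g (p.1.+1)%:Z (p.2.+1)%:Z
    = act (@fkern _ X Y Nx Ny (invsymb X Y)) (restr g) p by rewrite -fmult_fkern.
rewrite !invE -[lap _ _ _ _ _ _ _]/(restr (lap X Y Nx Ny phi') p) lap_fkern //.
rewrite massE //.
(* The implicit and explicit [beta] terms combine into the kernel acting on the increment, where
   [omega] cancels. *)
have -> : act (@fkern _ X Y Nx Ny (invsymb X Y)) (fun q => restr phi' q - restr phi q) p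
    = act (@fkern _ X Y Nx Ny (invsymb X Y)) (restr (gsub phi' (gconst omega))) p
      - act (@fkern _ X Y Nx Ny (invsymb X Y)) (restr (gsub phi (gconst omega))) p.
  rewrite /act -sumrB; apply: eq_bigr => q _.
  by rewrite /restr /gsub /gconst; ring.
have -> : act (nonlocal_kernel (@fkern _ X Y Nx Ny (invsymb X Y)) gam (M * (hx X Nx * hy Y Ny)))
    (defect omega (restr phi)) p
  = gam * act (@fkern _ X Y Nx Ny (invsymb X Y))
      (restr (gsub (gapp fphase phi) (gconst omega))) p
    + M * (hx X Nx * hy Y Ny * \sum_(q : 'I_Nx * 'I_Ny) defect omega (restr phi) q).
  rewrite /act !mulr_sumr -big_split; apply: eq_bigr => q _ /=.
  rewrite /nonlocal_kernel /restr /gsub /gapp /gconst /defect; ring.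
rewrite (is_derive_derive1 is_derive_fphase) => E.
rewrite -[(restr phi' p - _) / tau]/((phi' _ _ - phi _ _) / tau) E.
rewrite /restr; ring.
Qed.
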